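(* Let $n>2$ be an integer and $s\in(0,1)$. Let $p_1=\frac{n+2}{n-2}$, $U(x)=(1+|x|^2)^{-\frac{n-2}{2}}$ and $$\psi(x)=x\cdot\nabla U(x)+\frac{n-2}{2}U(x)=\frac{n-2}{2}\,\frac{1-|x|^2}{(1+|x|^2)^{n/2}},\qquad x\in\mathbb{R}^n.$$ Then $$\int_{\mathbb{R}^n}\log(U)\,U^{p_1}\psi\,dx>0\qquad\text{and}\qquad \langle U,\psi\rangle_s<0.$$
   Context: For $s\in(0,1)$, $\langle u,v\rangle_s=\int_{\mathbb{R}^n}\int_{\mathbb{R}^n}\frac{(u(x)-u(y))(v(x)-v(y))}{|x-y|^{n+2s}}\,dy\,dx$. *)

(* Defs.v *)
From HB Require Import structures.
From mathcomp Require Import all_boot all_order all_algebra.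
From mathcomp Require Import all_classical all_reals all_analysis.

Set Implicit Arguments.
Unset Strict Implicit.
Unset Printing Implicit Defensive.

Import Order.TTheory GRing.Theory Num.Theory.
Import numFieldNormedType.Exports.

Local Open Scope classical_set_scope.
Local Open Scope ring_scope.

(* R^n is 'rV[R]_n, with the product sigma-algebra, generated by the
   coordinate maps; it is the Borel sigma-algebra. *)
Definition rV_display : measure_display.
Proof. exact: default_measure_display. Qed.

Section measurable_rV.
Context (R : realType) (n : nat).

Let coords (i : 'I_n) (x : 'rV[R]_n) : measurableTypeR R := x ord0 i.

Let rV_set0 : g_sigma_preimage coords set0.
Proof. exact: sigma_algebra0. Qed.

Let rV_setC A : g_sigma_preimage coords A -> g_sigma_preimage coords (~` A).
Proof. exact: sigma_algebraC. Qed.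

Let rV_bigcup (F : (set 'rV[R]_n)^nat) :
  (forall i, g_sigma_preimage coords (F i)) ->
  g_sigma_preimage coords (\bigcup_i (F i)).
Proof. exact: sigma_algebra_bigcup. Qed.

HB.instance Definition _ := @isMeasurable.Build rV_display
  'rV[R]_n (g_sigma_preimage coords) rV_set0 rV_setC rV_bigcup.

Lemma measurable_coord (i : 'I_n) :
  measurable_fun [set: 'rV[R]_n] (fun x => x ord0 i : measurableTypeR R).
Proof.
move=> _ Y mY; rewrite setTI; apply: sub_sigma_algebra => /=.
rewrite -bigcup_seq/=; exists i => /=; first by rewrite mem_index_enum.
by exists Y => //; rewrite setTI.
Qed.

Lemma measurable_fun_rVP d (T : measurableType d) (f : T -> 'rV[R]_n) :
  (forall i, measurable_fun [set: T] (fun t => f t ord0 i : measurableTypeR R)) ->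
  measurable_fun [set: T] f.
Proof.
move=> mf _ A mA; rewrite setTI.
suff : [set B | measurable (f @^-1` B)] A by [].
move: A mA; apply: smallest_sub.
  split; first by rewrite /= preimage_set0.
    by move=> B /= mB; rewrite setTD preimage_setC; exact: measurableC.
  by move=> F /= mF; rewrite preimage_bigcup; exact: bigcupT_measurable.
move=> B; rewrite -bigcup_seq => -[i _ [C mC <-]] /=.
rewrite setTI -comp_preimage -[X in measurable X]setTI.
exact: mf.
Qed.

End measurable_rV.

(* The library declares this instance, but its canonical projection on \x is
   shadowed by an earlier one. *)
Lemma product_sigma_finite d1 d2 (T1 : measurableType d1)
    (T2 : measurableType d2) (R : realType)
    (m1 : {sigma_finite_measure set T1 -> \bar R})
    (m2 : {sigma_finite_measure set T2 -> \bar R}) :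
  sigma_finite setT (m1 \x m2)%E.
Proof.
have /sigma_finiteP[F [TF ndF Foo]] := sigma_finiteT m1.
have /sigma_finiteP[G [TG ndG Goo]] := sigma_finiteT m2.
exists (fun n => F n `*` G n).
  rewrite -setXTT TF TG predeqE => -[x y]; split.
    move=> [/= [n _ Fnx] [k _ Gky]]; exists (maxn n k) => //; split.
    - by move: x Fnx; exact/subsetPset/ndF/leq_maxl.
    - by move: y Gky; exact/subsetPset/ndG/leq_maxr.
  by move=> [n _ []/= ? ?]; split; exists n.
move=> k; have [? ?] := Foo k; have [? ?] := Goo k.
split; first exact: measurableX.
by rewrite product_measure1E// lte_mul_pinfty// ge0_fin_numE.
Qed.

Section lebesgue_rV.
Context (R : realType).

Definition consrV n (z : measurableTypeR R * 'rV[R]_n) : 'rV[R]_n.+1 :=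
  \row_i oapp (z.2 ord0) z.1 (unlift ord0 i).

Definition unconsrV n (x : 'rV[R]_n.+1) : measurableTypeR R * 'rV[R]_n :=
  (x ord0 ord0, \row_j x ord0 (lift ord0 j)).

Lemma consrV0 n (z : measurableTypeR R * 'rV[R]_n) : consrV z ord0 ord0 = z.1.
Proof. by rewrite mxE unlift_none. Qed.

Lemma consrV_lift n (z : measurableTypeR R * 'rV[R]_n) j :
  consrV z ord0 (lift ord0 j) = z.2 ord0 j.
Proof. by rewrite mxE liftK. Qed.

Lemma consrVK n : cancel (@consrV n) (@unconsrV n).
Proof.
move=> [a v]; rewrite /unconsrV consrV0; congr pair.
by apply/rowP => j; rewrite mxE consrV_lift.
Qed.

Lemma measurable_consrV n : measurable_fun setT (@consrV n).
Proof.
apply: measurable_fun_rVP => i.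
have [j ->|->] := unliftP ord0 i.
  under eq_fun do rewrite consrV_lift.
  exact: (measurableT_comp (measurable_coord j) measurable_snd).
under eq_fun do rewrite consrV0.
exact: measurable_fst.
Qed.

Lemma measurable_unconsrV n : measurable_fun setT (@unconsrV n).
Proof.
apply/measurable_fun_pair; first exact: measurable_coord.
apply: measurable_fun_rVP => i.
under eq_fun do rewrite mxE.
exact: measurable_coord.
Qed.

Section step.
Context n (mu : {sigma_finite_measure set 'rV[R]_n -> \bar R}).

Definition lebesgue_step : set 'rV[R]_n.+1 -> \bar R :=
  pushforward (lebesgue_measure \x mu)%E (@consrV n).

Let step0 : lebesgue_step set0 = 0%E.
Proof. by rewrite /lebesgue_step /pushforward preimage_set0 measure0. Qed.

Let step_ge0 A : (0 <= lebesgue_step A)%E.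
Proof. by rewrite /lebesgue_step /pushforward measure_ge0. Qed.

Let step_sigma_additive : semi_sigma_additive lebesgue_step.
Proof.
move=> F mF tF mUF; rewrite /lebesgue_step /pushforward preimage_bigcup.
apply: measure_semi_sigma_additive.
- by move=> k; rewrite -[X in measurable X]setTI; exact: measurable_consrV.
- apply/trivIsetP => /= i j _ _ ij; rewrite -preimage_setI.
  by move/trivIsetP : tF => /(_ _ _ _ _ ij) ->//; rewrite preimage_set0.
- rewrite -preimage_bigcup -[X in measurable X]setTI.
  exact: measurable_consrV.
Qed.

HB.instance Definition _ := isMeasure.Build _ _ _
  lebesgue_step step0 step_ge0 step_sigma_additive.

Let step_sigma_finite : sigma_finite setT lebesgue_step.
Proof.
have [F FT Foo] := product_sigma_finite (@lebesgue_measure R) mu.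
exists (fun k => @unconsrV n @^-1` F k).
  by rewrite -preimage_bigcup -FT preimage_setT.
move=> k; have [mF Fk] := Foo k; split.
  by rewrite -[X in measurable X]setTI; exact: measurable_unconsrV.
rewrite /lebesgue_step /pushforward -comp_preimage.
rewrite (_ : _ \o _ = id) ?preimage_id//.
by apply/funext => z /=; rewrite consrVK.
Qed.

HB.instance Definition _ := Measure_isSigmaFinite.Build _ _ _
  lebesgue_step step_sigma_finite.

End step.

(* Lebesgue measure on R^n, as the n-fold product of Lebesgue measure on R;
   lebesgue_rV_box gives its value on boxes. *)
Fixpoint lebesgue_rV n : {sigma_finite_measure set 'rV[R]_n -> \bar R} :=
  if n is m.+1 then lebesgue_step (lebesgue_rV m) else \d_(0 : 'rV[R]_0).

Lemma lebesgue_rV_box n (A : 'I_n -> set (measurableTypeR R)) :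
  (forall i, measurable (A i)) ->
  lebesgue_rV n [set x | forall i, A i (x ord0 i)] =
  (\prod_(i < n) lebesgue_measure (A i))%E.
Proof.
elim: n A => [|n IH] A mA.
  by rewrite big_ord0 /= diracE mem_set//= => -[].
rewrite big_ord_recl -IH; last by move=> i; exact: mA.
have mbox : measurable [set x : 'rV[R]_n | forall i, A (lift ord0 i) (x ord0 i)].
  rewrite (_ : mkset _ = \bigcap_(i in [set: 'I_n])
      ((fun x : 'rV[R]_n => x ord0 i : measurableTypeR R) @^-1` A (lift ord0 i))).
    apply: fin_bigcap_measurable => // i _.
    by rewrite -[X in measurable X]setTI; exact: measurable_coord.
  by apply/seteqP; split => [x /= + i _|x /= + i]; exact.
rewrite -product_measure1E//=.
rewrite /lebesgue_step /pushforward; congr product_measure1.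
apply/seteqP; split => z /=.
  move=> Az; split; first by rewrite -(consrV0 z); exact: Az.
  by move=> i /=; rewrite -consrV_lift; exact: Az.
move=> [Az0 Az] i; have [j ->|->] := unliftP ord0 i.
  by rewrite consrV_lift; exact: Az.
by rewrite consrV0.
Qed.

End lebesgue_rV.

Section euclidean.
Context (R : realType) (n : nat).
Implicit Types (x y : 'rV[R]_n) (f : 'rV[R]_n -> R).

Definition dotrV x y : R := \sum_(i < n) x ord0 i * y ord0 i.

(* `|x| is the sup norm on 'rV[R]_n *)
Definition enorm x : R := Num.sqrt (dotrV x x).

Definition gradrV f x : 'rV[R]_n := \row_i 'D_(delta_mx ord0 i) f x.

End euclidean.

Section gagliardo.
Context (R : realType) (n : nat).
Implicit Types (s : R) (u v : 'rV[R]_n -> R) (x y : 'rV[R]_n).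

Definition gagliardo_kernel s u v x y : R :=
  (u x - u y) * (v x - v y) / enorm (x - y) `^ (n%:R + 2 * s).

Definition gagliardo s u v : \bar R :=
  (\int[lebesgue_rV R n]_x \int[lebesgue_rV R n]_y
     (gagliardo_kernel s u v x y)%:E)%E.

(* The double integral of a kernel of variable sign exists in [-oo, +oo]: its
   positive or its negative part has a finite integral. This has to be required
   on the side because +oo - oo = -oo in \bar R, so that gagliardo s u v < 0
   could otherwise hold for an integral that does not exist. *)
Definition gagliardo_exists s u v : Prop :=
  ((\int[lebesgue_rV R n]_x \int[lebesgue_rV R n]_y
     (Num.max (gagliardo_kernel s u v x y) 0)%:E < +oo) \/
   (\int[lebesgue_rV R n]_x \int[lebesgue_rV R n]_y
     (Num.max (- gagliardo_kernel s u v x y) 0)%:E < +oo))%E.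

End gagliardo.

Section bubble.
Context (R : realType) (n : nat).
Implicit Types x : 'rV[R]_n.

Definition bubble x : R := (1 + enorm x ^+ 2) `^ (- ((n%:R - 2) / 2)).

Definition bubble_psi x : R :=
  dotrV x (gradrV bubble x) + (n%:R - 2) / 2 * bubble x.

Definition critical_exponent : R := (n%:R + 2) / (n%:R - 2).

End bubble.

(* Main.v *)
(** Both integrals are compared with a quantity that is scaled by the dilations
    [x |-> mu x] and decays as [mu -> +oo]: integrating its [mu]-derivative over
    [1 <= mu], then over space, and scaling back by Tonelli, one finds that its
    integral at [mu = 1] is a positive multiple of the integral of the negative
    part of the derivative minus that of the positive part.

    Write [t = 1 + |x|^2]. For [t ^ (-n)] this gives
    [\int (t - 2) t ^ (-n - 1) = 0]. As [ln U * U ^ p1 * psi] is a positive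
    multiple of [ln t (t - 2) t ^ (-n - 1)], its integral does not change when
    [ln t] is replaced by [ln t - ln 2], which has the sign of [t - 2].

    For [mu ^ (n - 2) (U (mu x) - U (mu y))^2 / |x - y| ^ (n + 2 s)], the
    derivative is a power of [mu] times the kernel [K] of [<U, psi>_s] at
    [(mu x, mu y)], so the integral of [K^-] exceeds that of [K^+]. These
    integrals may be infinite, but that of [K^+] is not: with
    [v = t ^ (-1/2)], [U] and [psi] are polynomials in [v], oppositely
    monotone for [v^2 <= 1/6], so that [K > 0] forces [x] or [y] into a fixed
    ball, while [|K| <= C min(1, |x - y|^2) / |x - y| ^ (n + 2 s)]. *)

From HB Require Import structures.
Require Import Defs.
From mathcomp Require Import all_boot all_order all_algebra.
From mathcomp Require Import all_classical all_reals all_analysis.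
From mathcomp Require Import measurable_realfun.
From mathcomp Require Import ring lra.

Set Implicit Arguments.
Unset Strict Implicit.
Unset Printing Implicit Defensive.

Import Order.TTheory GRing.Theory Num.Theory.
Import numFieldNormedType.Exports.

Local Open Scope classical_set_scope.
Local Open Scope ring_scope.

(** * Affine changes of variable on the line *)

Section affine_change.
Context {R : realType}.
Implicit Types (a w : R).

Let affine a w (t : measurableTypeR R) : measurableTypeR R := a * t + w.

Let measurable_affine a w : measurable_fun setT (affine a w).
Proof. by apply: measurable_funD => //; apply: measurable_funM. Qed.

Let affine_ocitv a w (A : set (measurableTypeR R)) : a != 0 -> ocitv A ->
  (lebesgue_measure A = `|a|%:E * lebesgue_measure (affine a w @^-1` A))%E.
Proof.
move=> a0 [[x y] _ <-] /=.
have [a_gt0|a_lt0|/eqP] := ltgtP 0 a; last by rewrite eq_sym (negbTE a0).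
  rewrite (_ : _ @^-1` _ = `](x - w) / a, (y - w) / a]%classic); last first.
    apply/seteqP; split=> t /=; rewrite !in_itv/= /affine ltr_pdivrMr//;
      by rewrite ler_pdivlMr// mulrC ltrBlDr lerBrDr.
  rewrite !lebesgue_measure_itv/= !lte_fin ltr_pM2r ?invr_gt0// ltrD2r.
  case: ifPn => xy; rewrite ?mule0// -!EFinD -EFinM; congr EFin.
  by rewrite gtr0_norm//; field.
(* For [a < 0] the line is reversed: the preimage is closed on the left and open on the right, with
   the same length. *)
rewrite (_ : _ @^-1` _ = `[(y - w) / a, (x - w) / a[%classic); last first.
  apply/seteqP; split=> t /=; rewrite !in_itv/= /affine ltr_ndivlMr//;
    by rewrite ler_ndivrMr// mulrC ltrBlDr lerBrDr andbC.
rewrite !lebesgue_measure_itv/= !lte_fin ltr_nM2r ?invr_lt0// ltrD2r.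
case: ifPn => xy; rewrite ?mule0// -!EFinD -EFinM; congr EFin.
by rewrite ltr0_norm//; field.
Qed.

(** The pushforward of Lebesgue measure by the affine map, scaled by [|a|], agrees with Lebesgue
    measure on half-open intervals, hence everywhere by uniqueness. *)
Lemma integral_affine a w (f : measurableTypeR R -> \bar R) : a != 0 ->
  measurable_fun setT f -> (forall t, 0 <= f t)%E ->
  (\int[lebesgue_measure]_t f (a * t + w)%R =
   `|a|^-1%:E * \int[lebesgue_measure]_t f t)%E.
Proof.
move=> a0 mf f0.
have na0 : 0 <= `|a| by [].
pose m0 : {measure set (measurableTypeR R) -> \bar R} := lebesgue_measure.
pose m : {measure set (measurableTypeR R) -> \bar R} := mscale (NngNum na0)
  (measure_function_pushforward__canonical__measure_function_Measure
    m0 (measurable_affine a w)).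
have m0E A : measurable A -> A `<=` setT -> m0 A = m A.
  by move=> mA _; apply: (lebesgue_measure_unique (mu := m)) => // B
    /(affine_ocitv w a0).
rewrite -/m0 [in RHS](eq_measure_integral m m0E).
rewrite ge0_integral_mscale// muleA -EFinM mulVf ?normr_eq0// mul1e.
by rewrite ge0_integral_pushforward// => t _; exact: f0.
Qed.
End affine_change.

(** * Integration over [R^n] one coordinate at a time *)

Section integral_rV.
Context {R : realType}.
Local Open Scope ereal_scope.

Lemma integral_rVS n (f : 'rV[R]_n.+1 -> \bar R) :
  measurable_fun setT f -> (forall x, 0 <= f x) ->
  \int[lebesgue_rV R n.+1]_x f x =
  \int[lebesgue_measure]_t \int[lebesgue_rV R n]_v f (consrV (t, v)).
Proof.
move=> mf f0.
rewrite -(fubini_tonelli1 (f \o @consrV R n))//=; last first.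
  by apply: measurableT_comp => //; exact: measurable_consrV.
have /= <- := ge0_integral_pushforward (@measurable_consrV R n)
  (lebesgue_measure \x lebesgue_rV R n)%E measurableT mf (fun x _ => f0 x).
by [].
Qed.
End integral_rV.

Arguments lebesgue_rV : simpl never.

(** * Affine changes of variable and dilations on [R^n] *)

Section affine_change_rV.
Context {R : realType}.

Lemma consrV_affine n (a : R) (w : 'rV[R]_n.+1)
    (z : measurableTypeR R * 'rV[R]_n) :
  a *: consrV z + w =
  consrV (a * z.1 + (unconsrV w).1, a *: z.2 + (unconsrV w).2).
Proof.
apply/rowP => i; have [j ->|->] := unliftP ord0 i.
  by rewrite mxE [X in X + _]mxE !consrV_lift/= !mxE.
by rewrite mxE [X in X + _]mxE !consrV0.
Qed.

Lemma measurable_affine_rV n (a : R) (w : 'rV[R]_n) :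
  measurable_fun setT (fun x : 'rV[R]_n => a *: x + w).
Proof.
apply: measurable_fun_rVP => i.
under eq_fun do rewrite !mxE.
by apply: measurable_funD => //; apply: measurable_funM => //;
  exact: measurable_coord.
Qed.

Lemma measurable_dilate_rV {n} : measurable_fun setT
  (fun w : measurableTypeR R * 'rV[R]_n => w.1 *: w.2).
Proof.
apply: measurable_fun_rVP => i.
under eq_fun do rewrite mxE.
apply: measurable_funM; first exact: measurable_fst.
exact: (measurableT_comp (measurable_coord i) measurable_snd).
Qed.

Local Open Scope ereal_scope.

(** Induction on the dimension: [consrV_affine] splits off the first coordinate, and each coordinate
    contributes a factor [|a|^-1]. *)
Lemma integral_affine_rV n (a : R) (w : 'rV[R]_n) (f : 'rV[R]_n -> \bar R) :
  a != 0%R -> measurable_fun setT f -> (forall x, 0 <= f x) ->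
  \int[lebesgue_rV R n]_x f (a *: x + w)%R =
  (`|a| ^- n)%:E * \int[lebesgue_rV R n]_x f x.
Proof.
move=> a0; elim: n w f => [|n IHn] w f mf f0.
  rewrite expr0 invr1 mul1e; apply: eq_integral => x _.
  by congr f; apply/rowP => -[].
have mcons t : measurable_fun setT (fun v : 'rV[R]_n => consrV (t, v)).
  by apply: measurableT_comp;
    [exact: measurable_consrV|exact: measurable_fun_pair].
rewrite integral_rVS//; last first.
  exact: (measurableT_comp mf (measurable_affine_rV a w)).
under eq_integral => t _.
  under eq_integral do rewrite consrV_affine/=.
  rewrite (IHn _ (fun v => f (consrV (a * t + (unconsrV w).1, v)%R)))//;
    last first.
    by apply: measurableT_comp => //; exact: mcons.
  over.
rewrite ge0_integralZl//=; last first.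
- by move=> t _; exact: integral_ge0.
- have := @measurable_fun_fubini_tonelli_F _ _ _ _ _ (lebesgue_rV R n)
    (fun z : measurableTypeR R * 'rV[R]_n => f (consrV z)).
  move=> /(_ (measurableT_comp mf (@measurable_consrV R n)) (fun z => f0 _)) mF.
  apply: (measurableT_comp mF).
  by apply: measurable_funD => //; apply: measurable_funM.
rewrite (integral_affine _ (f := fun t => \int[lebesgue_rV R n]_v f (consrV (t,
  v)))) //=.
- by rewrite -integral_rVS// muleA -EFinM -invfM -exprSr.
- exact: (@measurable_fun_fubini_tonelli_F _ _ _ _ _ (lebesgue_rV R n)
    (fun z : measurableTypeR R * 'rV[R]_n => f (consrV z))
    (measurableT_comp mf (@measurable_consrV R n))).
- by move=> t; exact: integral_ge0.
Qed.

Lemma integral_dilate_rV {n} (mu : R) (f : 'rV[R]_n -> \bar R) : (1 <= mu)%R ->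
  measurable_fun setT f -> (forall x, 0 <= f x) ->
  \int[lebesgue_rV R n]_x f (mu *: x)%R =
  (mu `^ (- n%:R))%:E * \int[lebesgue_rV R n]_x f x.
Proof.
move=> mu1 mf f0; have mu0 : (0 < mu)%R by lra.
rewrite powR_invn ?ltW// -[in RHS](gtr0_norm mu0).
rewrite -(integral_affine_rV 0) ?gt_eqF//.
by apply: eq_integral => x _; rewrite addr0.
Qed.

End affine_change_rV.

(** * The Euclidean norm, balls and cubes *)

Lemma measurable_sqrt (R : realType) :
  measurable_fun [set: measurableTypeR R] (Num.sqrt : R -> R).
Proof. by apply: continuous_measurable_fun; exact: sqrt_continuous. Qed.

Section euclidean_norm.
Context {R : realType} {n : nat}.
Implicit Types x y : 'rV[R]_n.

Lemma dotrV_ge0 x : 0 <= dotrV x x.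
Proof. by apply: sumr_ge0 => i _; rewrite -expr2 sqr_ge0. Qed.

Lemma enorm_ge0 x : 0 <= enorm x.
Proof. exact: sqrtr_ge0. Qed.

Lemma sqr_enorm x : enorm x ^+ 2 = \sum_(i < n) x ord0 i ^+ 2.
Proof.
by rewrite sqr_sqrtr ?dotrV_ge0//; apply: eq_bigr => i _; rewrite expr2.
Qed.

Lemma ler_coord_enorm x i : `|x ord0 i| <= enorm x.
Proof.
rewrite -ler_sqr ?nnegrE ?enorm_ge0// sqr_enorm real_normK ?num_real//.
by rewrite (bigD1 i)//= lerDl sumr_ge0// => j _; rewrite sqr_ge0.
Qed.

Lemma enorm_eq0 x : enorm x = 0 -> x = 0.
Proof.
move=> x0; apply/rowP => i; rewrite mxE; apply/eqP.
by rewrite -normr_le0 -x0 ler_coord_enorm.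
Qed.

Lemma enormZ a x : enorm (a *: x) = `|a| * enorm x.
Proof.
apply/eqP; rewrite -(@eqrXn2 _ 2)// ?mulr_ge0 ?enorm_ge0//.
rewrite exprMn !sqr_enorm mulr_sumr real_normK ?num_real//; apply/eqP.
by apply: eq_bigr => i _; rewrite mxE exprMn.
Qed.

Lemma measurable_enorm : measurable_fun setT (@enorm R n).
Proof.
apply: measurableT_comp; first exact: measurable_sqrt.
rewrite (_ : (fun _ => _) = (fun x => \sum_(i < n) x ord0 i * x ord0 i))//.
apply: measurable_sum => i.
by apply: measurable_funM; exact: measurable_coord.
Qed.

Definition cube (a b : R) : set 'rV[R]_n := [set x | forall i,
  a <= x ord0 i <= b].

Let segment (a b : R) : set (measurableTypeR R) := `[a, b]%classic.

Let cubeE a b : cube a b = [set x | forall i, segment a b (x ord0 i)].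
Proof. by apply/seteqP; split=> x /= + i => /(_ i);
  rewrite /segment/= in_itv. Qed.

Lemma measurable_cube a b : measurable (cube a b).
Proof.
rewrite cubeE (_ : (fun _ => _) = \bigcap_(i in [set: 'I_n])
    ((fun x : 'rV[R]_n => x ord0 i : measurableTypeR R) @^-1` segment a b)).
  apply: fin_bigcap_measurable => // i _.
  rewrite -[X in measurable X]setTI; apply: measurable_coord => //.
  exact: measurable_itv.
by apply/seteqP; split => [x /= + i _|x /= + i]; exact.
Qed.

Lemma lebesgue_rV_cube a b : a < b ->
  lebesgue_rV R n (cube a b) = ((b - a) ^+ n)%:E.
Proof.
move=> ab; rewrite cubeE (lebesgue_rV_box (A := fun=> segment a b)); last first.
  by move=> i; exact: measurable_itv.
transitivity (\prod_(i < n) (b - a)%:E)%E.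
  apply: eq_bigr => i _.
  by rewrite /segment lebesgue_measure_itv/= lte_fin ab EFinB.
by rewrite prodEFin prodr_const card_ord.
Qed.

Lemma measurable_enorm_ball r : measurable [set z : 'rV[R]_n | enorm z <= r].
Proof.
rewrite (_ : mkset _ = @enorm R n @^-1` [set` `]-oo, r]]); last first.
  by apply/seteqP; split=> x /=; rewrite in_itv.
by rewrite -[X in measurable X]setTI; exact: measurable_enorm.
Qed.

Lemma lebesgue_rV_ball_lty (r : R) :
  (lebesgue_rV R n [set x | (enorm x <= r)%R] < +oo)%E.
Proof.
(* The half-side [|r| + 1] is positive for every real [r], so the cube is nondegenerate. *)
apply: (@le_lt_trans _ _ (lebesgue_rV R n (cube (- (`|r| + 1)) (`|r| + 1)))).
  apply: le_measure; rewrite ?inE.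
  - exact: measurable_enorm_ball.
  - exact: measurable_cube.
  move=> x /= xr i; rewrite -ler_norml (le_trans (ler_coord_enorm x i))//.
  by rewrite (le_trans xr)// (le_trans (ler_norm r)) ?lerDl.
by rewrite lebesgue_rV_cube ?ltry// gtrN// addr_gt0.
Qed.

End euclidean_norm.

(** * The fundamental theorem of calculus on a ray, split by sign *)

Section FTC_ray.
Context {R : realType}.
Implicit Types p q : R -> R.
Local Notation leb := (@lebesgue_measure R).

Local Lemma continuous_integrable_segment q (N : R) : (forall t : R, 1 <= t ->
  {for t, continuous q}) ->
  leb.-integrable `[1, N] (EFin \o q).
Proof.
move=> cq; apply: continuous_compact_integrable; first exact: segment_compact.
apply: continuous_in_subspaceT => t; rewrite inE/= in_itv/= => /andP[t1 _].
exact: cq.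
Qed.

(** On a segment both parts of [q] have finite integrals; the identity is written without
    subtraction so that it survives infinite limits. *)
Local Lemma FTC_segment p q (N : R) : 1 < N ->
  (forall t : R, 1 <= t -> is_derive t 1 p (q t)) ->
  (forall t : R, 1 <= t -> {for t, continuous q}) ->
  (\int[leb]_(t in `[1%R, N]) (Num.max (- q t) 0)%:E =
   (p 1 - p N)%:E + \int[leb]_(t in `[1%R, N]) (Num.max (q t) 0)%:E)%E.
Proof.
move=> N1 dp cq.
have iq := @continuous_integrable_segment q N cq.
have cp (t : R) : 1 <= t -> {for t, continuous p}.
  by move=> /dp[dpt _]; exact/differentiable_continuous/derivable1_diffP.
have FTC : (\int[leb]_(x in `[1%R, N]) (q x)%:E = (p N)%:E - (p 1)%:E)%E.
  apply: continuous_FTC2 => //.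
  - apply: continuous_in_subspaceT => t; rewrite inE/= in_itv/= => /andP[t1 _].
    exact: cq.
  - split.
    + by move=> t; rewrite in_itv/= => /andP[/ltW /dp[]].
    + by apply: cvg_at_right_filter; exact: cp.
    + by apply: cvg_at_left_filter; apply: cp; exact: ltW.
  - by move=> t; rewrite in_itv/= derive1E => /andP[/ltW /dp[]].
have : (\int[leb]_(x in `[1%R, N]) (q x)%:E =
    \int[leb]_(t in `[1%R, N]) (Num.max (q t) 0)%:E -
    \int[leb]_(t in `[1%R, N]) (Num.max (- q t) 0)%:E)%E.
  rewrite integralE; congr (_ - _)%E; apply: eq_integral => t _.
    by rewrite funeposE EFin_max.
  by rewrite funenegE -EFinN EFin_max.
rewrite {}FTC.
have ipos : leb.-integrable `[1, N] (fun t => (Num.max (q t) 0)%:E).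
  apply: eq_integrable (integrable_funepos _ iq) => //.
  by move=> t _; rewrite funeposE EFin_max.
have ineg : leb.-integrable `[1, N] (fun t => (Num.max (- q t) 0)%:E).
  apply: eq_integrable (integrable_funeneg _ iq) => //.
  by move=> t _; rewrite funenegE -EFinN EFin_max.
have mI : measurable (`[1, N]%classic : set (measurableTypeR R)).
  exact: measurable_itv.
have := integrable_fin_num mI ipos; have := integrable_fin_num mI ineg.
case: (\int[leb]_(t in _) (Num.max (- q t) _)%:E)%E => [a| |]//.
case: (\int[leb]_(t in _) (Num.max (q t) _)%:E)%E => [b| |]//.
by move=> _ _ [] h; congr EFin; lra.
Qed.

(** Each part converges separately by monotone convergence over growing segments, so the identity
    holds even when both integrals are infinite. *)
Lemma FTC_ray_pos_neg p q :
  (forall t : R, 1 <= t -> is_derive t 1 p (q t)) ->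
  (forall t : R, 1 <= t -> {for t, continuous q}) ->
  p t @[t --> +oo] --> 0 ->
  (\int[leb]_(t in `[1%R, +oo[) (Num.max (- q t) 0)%:E =
   (p 1)%:E + \int[leb]_(t in `[1%R, +oo[) (Num.max (q t) 0)%:E)%E.
Proof.
move=> dp cq p0.
(* The right end is [k + 2] because [FTC_segment] asks for [1 < N]. *)
pose I (k : nat) : set R := `[1, k.+2%:R]%classic.
have IE : \bigcup_k I k = `[1, +oo[%classic.
  apply/seteqP; split=> [t [k _]|t] /=; rewrite !in_itv/= ?andbT.
    by case/andP.
  move=> t1; exists (Num.truncn t) => //=; rewrite /I/= in_itv/= t1/=.
  have := truncn_itv (le_trans ler01 t1) => /andP[_ /ltW].
  by move=> /le_trans; apply; rewrite ler_nat.
have ndI : nondecreasing_seq I.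
  move=> m k mk; rewrite subsetEset => t;
    rewrite /I/= !in_itv/= => /andP[-> /=].
  by move=> /le_trans; apply; rewrite ler_nat !ltnS.
have mI k : measurable (I k) by exact: measurable_itv.
have mmax (r : R -> R) k : (forall t : R, 1 <= t -> {for t, continuous r}) ->
    measurable_fun (I k) (fun t => (Num.max (r t) 0)%:E).
  move=> cr; apply/measurable_EFinP; apply: measurable_maxr => //.
  apply/measurable_EFinP.
  by have /integrableP[] := @continuous_integrable_segment r k.+2%:R cr.
have cqN (t : R) : 1 <= t -> {for t, continuous (\- q)}.
  by move=> /cq; exact: continuousN.
have cvgI (r : R -> R) : (forall t : R, 1 <= t -> {for t, continuous r}) ->
    (\int[leb]_(t in I k) (Num.max (r t) 0)%:E @[k --> \oo] -->
     \int[leb]_(t in `[1%R, +oo[) (Num.max (r t) 0)%:E)%E.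
  move=> cr; rewrite -IE; apply: ge0_nondecreasing_set_cvg_integral => //.
    by move=> k; exact: mmax.
  by move=> k t _; rewrite lee_fin le_max lexx orbT.
apply: (cvg_unique _ (cvgI _ cqN)) => //.
rewrite (_ : (fun k => _) = fun k => ((p 1 - p k.+2%:R)%:E +
    \int[leb]_(t in I k) (Num.max (q t) 0)%:E)%E); last first.
  by apply/funext => k; apply: FTC_segment => //; rewrite ltr1n.
apply: cvgeD; [by []| |exact: cvgI].
apply: cvg_EFin; first by near=> k.
rewrite -[X in _ --> X]subr0; apply: cvgB; first exact: cvg_cst.
apply: (cvg_comp _ _ _ p0).
apply/cvgryPge => A; near=> k.
apply: (@le_trans _ _ k%:R); last by rewrite ler_nat ltnW.
by near: k; exact: nbhs_infty_ger.
Unshelve. all: by end_near. Qed.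
End FTC_ray.

(** * Powers on the ray from 1 *)

Section ray_weight.
Context {R : realType}.
Local Notation leb := (@lebesgue_measure R).

(** The cutoff below 1 turns integrals over the ray into integrals over the whole line, to which
    Tonelli's theorem applies. *)
Definition ray_weight (e mu : R) : R := if 1 <= mu then mu `^ e else 0.

Lemma ray_weight_ge0 e mu : 0 <= ray_weight e mu.
Proof. by rewrite /ray_weight; case: ifP => // _; exact: powR_ge0. Qed.

Lemma ray_weightE e : EFin \o ray_weight e = (EFin \o (@powR R)^~ e) \_ `[1,
  +oo[.
Proof.
apply/funext => mu; rewrite /= patchE /ray_weight.
have -> : (mu \in `[1, +oo[%classic) = (1 <= mu).
  by apply/idP/idP; rewrite inE/= in_itv/= andbT.
by case: ifP.
Qed.

Lemma measurable_ray_weight e :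
  measurable_fun [set: measurableTypeR R] (ray_weight e : measurableTypeR R ->
    R).
Proof.
apply/(@measurable_EFinP _ (measurableTypeR R)); rewrite ray_weightE.
apply/(measurable_restrictT (D := [set` `[1, +oo[] : set (measurableTypeR R)));
  first exact: measurable_itv.
by apply/measurable_EFinP; apply: measurable_funTS; exact: measurable_powR.
Qed.

Lemma integral_ray_weight e (f : R -> \bar R) :
  (\int[leb]_mu ((ray_weight e mu)%:E * f mu) =
   \int[leb]_(mu in `[1%R, +oo[) ((mu `^ e)%:E * f mu))%E.
Proof.
rewrite [RHS]integral_mkcond; apply: eq_integral => mu _; rewrite patchE.
have -> : (mu \in `[1, +oo[%classic) = (1 <= mu).
  by apply/idP/idP; rewrite inE/= in_itv/= andbT.
by rewrite /ray_weight; case: ifP => //; rewrite mul0e.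
Qed.

Lemma powR_cvgy0 (e : R) : e < 0 -> t `^ e @[t --> +oo%R] --> 0.
Proof.
move=> e0; have Ne0 : 0 < - e by rewrite oppr_gt0.
rewrite (_ : (@powR R)^~ e = (fun t : R => (t `^ (- e))^-1)); last first.
  by apply/funext => t; rewrite -powRN opprK.
apply/(gtr0_cvgV0 (f := fun t : R => t `^ (- e))); first by near=> t;
  apply: powR_gt0.
apply/cvgryPge => A; near=> t.
have [A0|A0] := leP A 0; first by rewrite (le_trans A0)// powR_ge0.
have -> : A = (A `^ (- e)^-1) `^ (- e).
  by rewrite -powRrM mulVf ?gt_eqF// powRr1// ltW.
apply: ge0_ler_powR; [exact: ltW|by rewrite nnegrE powR_ge0|rewrite nnegrE|];
  by near: t; apply: nbhs_pinfty_ge; exact: num_real.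
Unshelve. all: end_near. Qed.

(** An instance of [FTC_ray_pos_neg] with [q] equal to [- t ^ e]: its positive part vanishes, and
    only the value at 1 of the decaying antiderivative remains. *)
Lemma integral_ray_weightE (e : R) : e < -1 ->
  (\int[leb]_mu (ray_weight e mu)%:E = (- (e + 1))^-1%:E)%E.
Proof.
move=> e1; have e1N : 0 < - (e + 1) by lra.
under eq_integral do rewrite -[X in X%:E]mulr1 EFinM.
rewrite integral_ray_weight.
have dp (t : R) : 1 <= t ->
  is_derive t 1 (fun u => (- (e + 1))^-1 * u `^ (e + 1)) (- t `^ e).
  move=> t1; have t0 : 0 < t by lra.
  apply: (is_derive_eq (is_deriveZ _ (is_derive1_powR (e + 1) t0))).
  by rewrite addrK /GRing.scale/=; field; lra.
have cq (t : R) : 1 <= t -> {for t, continuous (fun u => - u `^ e)}.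
  move=> t1; have t0 : 0 < t by lra.
  by apply: continuousN; apply/differentiable_continuous/derivable1_diffP;
    apply: derivable_powR; rewrite in_itv/= t0.
have := FTC_ray_pos_neg dp cq.
rewrite powR1 mulr1 [X in (_ + X)%E]integral0_eq ?adde0; last first.
  by move=> t; rewrite /= in_itv/= => _; rewrite max_r// oppr_le0 powR_ge0.
move=> <-.
  by apply: eq_integral => t _; rewrite opprK mule1 max_l// powR_ge0.
rewrite -[X in _ --> X](mulr0 (- (e + 1))^-1).
by apply: cvgM; [exact: cvg_cst|apply: powR_cvgy0; lra].
Qed.
End ray_weight.

(** * Integrals along the orbits of a family of dilations *)

Section dilation.
Context {R : realType} {d : measure_display} {T : measurableType d}.
Variable m : {sigma_finite_measure set T -> \bar R}.
Variables (delta : measurableTypeR R -> T -> T) (k : R).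
Hypothesis mdelta : measurable_fun setT (fun z : measurableTypeR R * T => delta
  z.1 z.2).
Hypothesis integral_delta : forall mu (f : T -> \bar R), 1 <= mu ->
  measurable_fun setT f -> (forall x, 0 <= f x)%E ->
  (\int[m]_x f (delta mu x) = (mu `^ k)%:E * \int[m]_x f x)%E.
Local Notation leb := (@lebesgue_measure R).
Local Open Scope ereal_scope.

Lemma measurable_ray_dilation e (f : T -> \bar R) : measurable_fun setT f ->
  measurable_fun setT (fun z : T * measurableTypeR R =>
    (ray_weight e z.2)%:E * f (delta z.2 z.1)).
Proof.
move=> mf; apply: emeasurable_funM.
  apply/measurable_EFinP.
  exact: (measurableT_comp (measurable_ray_weight e) measurable_snd).
apply: (measurableT_comp mf).
have mswap : measurable_fun setT (fun z : T * measurableTypeR R => (z.2, z.1)).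
  by apply: measurable_fun_pair.
exact: (measurableT_comp mdelta mswap).
Qed.

(** Integrating over [T] first, each [mu] yields [mu ^ k] times the integral of [f]. The family is
    abstract because it will be dilations of [R^n], contractions of [R^n], and dilations of
    pairs. *)
Lemma integral_ray_dilation e (f : T -> \bar R) :
  measurable_fun setT f -> (forall x, 0 <= f x) ->
  \int[m]_x \int[leb]_mu ((ray_weight e mu)%:E * f (delta mu x)) =
  (\int[leb]_mu (ray_weight (e + k) mu)%:E) * \int[m]_x f x.
Proof.
move=> mf f0.
rewrite (fubini_tonelli (fun z : T * measurableTypeR R =>
    (ray_weight e z.2)%:E * f (delta z.2 z.1)))//=; last 2 first.
- exact: measurable_ray_dilation.
- by move=> z; rewrite mule_ge0// lee_fin ray_weight_ge0.
rewrite -ge0_integralZr//; last 3 first.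
- by apply/measurable_EFinP; exact: measurable_ray_weight.
- by move=> mu _; rewrite lee_fin ray_weight_ge0.
- exact: integral_ge0.
apply: eq_integral => mu _.
rewrite ge0_integralZl//; last 2 first.
- apply: (measurableT_comp mf).
  have mpair : measurable_fun setT (fun x : T => (mu, x)).
    by apply: measurable_fun_pair.
  exact: (measurableT_comp mdelta mpair).
- by rewrite lee_fin ray_weight_ge0.
rewrite /ray_weight; case: ifPn => mu1; last by rewrite !mul0e.
rewrite integral_delta// muleA -EFinM -powRD//.
by apply/implyP => _; rewrite gt_eqF// (lt_le_trans ltr01).
Qed.

End dilation.

(** * Integrability of powers of the norm near 0 and at infinity *)

Section euclidean_weights.
Context {R : realType} {n : nat}.
Local Notation leb := (@lebesgue_measure R).
Local Notation mu_n := (lebesgue_rV R n).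
Implicit Types (z : 'rV[R]_n) (r : R).

Let ball_ind r z : \bar R := (if enorm z <= r then 1 else 0)%:E.

Let measurable_ball_ind r : measurable_fun setT (ball_ind r).
Proof.
apply/measurable_EFinP; apply: measurable_fun_ifT => //.
by apply: measurable_fun_ler => //; exact: measurable_enorm.
Qed.

Let integral_ball_ind_lty r : (\int[mu_n]_z ball_ind r z < +oo)%E.
Proof.
rewrite (_ : ball_ind r = EFin \o \1_[set z : 'rV[R]_n | enorm z <= r]).
  rewrite integral_indic// ?setIT; last exact: measurable_enorm_ball.
  exact: lebesgue_rV_ball_lty.
apply/funext => z /=; rewrite indicE /ball_ind; congr EFin.
case: ifPn => [zr|/negP zr]; first by rewrite mem_set.
by rewrite memNset.
Qed.

Lemma integral_ge_segment (g : measurableTypeR R -> \bar R) (a b c : R) :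
  measurable_fun setT g -> (forall t, 0 <= g t)%E -> a <= b -> 0 <= c ->
  (forall t : R, a <= t <= b -> (c%:E <= g t)%E) ->
  ((c * (b - a))%:E <= \int[leb]_t g t)%E.
Proof.
move=> mg g0 ab c0 cg.
have mI : measurable (`[a, b]%classic : set (measurableTypeR R)).
  exact: measurable_itv.
apply: (@le_trans _ _ (\int[leb]_(t in `[a, b]) g t)%E); last first.
  by apply: ge0_subset_integral => //.
have -> : (c * (b - a))%:E = (\int[leb]_(t in `[a, b]) c%:E)%E.
  rewrite integral_cst//= lebesgue_measure_itv/= lte_fin.
  have [ab'|] := ltP a b; first by rewrite -EFinB -EFinM.
  by move=> ba; rewrite (@le_anti _ _ a b) ?ab// subrr mulr0 mule0.
by apply: ge0_le_integral => //; exact: measurable_funTS.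
Qed.

Let measurable_dilate (g : R ->
  R) : measurable_fun [set: measurableTypeR R] (g : measurableTypeR R -> R) ->
  measurable_fun setT (fun z : measurableTypeR R * 'rV[R]_n => g z.1 *: z.2).
Proof.
move=> mg; apply: measurable_fun_rVP => i.
under eq_fun do rewrite mxE.
apply: measurable_funM; first exact: (measurableT_comp mg measurable_fst).
exact: (measurableT_comp (measurable_coord i) measurable_snd).
Qed.

Lemma powRVl (x a : R) : 0 <= x -> x^-1 `^ a = x `^ (- a).
Proof. by move=> x0; rewrite -powR_inv1// -powRrM mulN1r. Qed.

Let measurable_ray (delta : measurableTypeR R -> 'rV[R]_n -> 'rV[R]_n) e z r :
  measurable_fun setT (fun w : measurableTypeR R * 'rV[R]_n => delta w.1 w.2) ->
  measurable_fun [set: measurableTypeR R]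
    (fun mu => (ray_weight e mu)%:E * ball_ind r (delta mu z))%E.
Proof.
move=> mdelta.
have mpair : measurable_fun setT (fun mu : measurableTypeR R => (z, mu)).
  by apply: measurable_fun_pair.
exact: (measurableT_comp
  (measurable_ray_dilation mdelta e (measurable_ball_ind r)) mpair).
Qed.

(** A substitute for polar coordinates: [h] is bounded by an integral of ball indicators along
    orbits, whose integral over space is a constant times the volume of one ball, the constant being
    finite as [e + k < -1]. *)
Let integral_le_ray_lty (delta : measurableTypeR R -> 'rV[R]_n -> 'rV[R]_n)
    (e k r C : R) (h : 'rV[R]_n -> R) :
  measurable_fun setT (fun w : measurableTypeR R * 'rV[R]_n => delta w.1 w.2) ->
  (forall mu (f : 'rV[R]_n -> \bar R), 1 <= mu ->
    measurable_fun setT f -> (forall x, 0 <= f x)%E ->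
    (\int[mu_n]_x f (delta mu x) = (mu `^ k)%:E * \int[mu_n]_x f x)%E) ->
  e + k < -1 -> measurable_fun setT h -> (forall z, 0 <= h z) -> 0 <= C ->
  (forall z, ((h z)%:E <= C%:E * \int[leb]_mu
     ((ray_weight e mu)%:E * ball_ind r (delta mu z)))%E) ->
  (\int[mu_n]_z (h z)%:E < +oo)%E.
Proof.
move=> mdelta deltaE ek mh h0 C0 hC.
have ind0 z : (0 <= ball_ind r z)%E by rewrite /ball_ind; case: ifP.
have int0 z : (0 <= \int[leb]_mu
     ((ray_weight e mu)%:E * ball_ind r (delta mu z)))%E.
  by apply: integral_ge0 => mu _; rewrite mule_ge0// lee_fin ray_weight_ge0.
have mint : measurable_fun setT (fun z => \int[leb]_mu
     ((ray_weight e mu)%:E * ball_ind r (delta mu z)))%E.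
  apply: (measurable_fun_fubini_tonelli_F (m2 := leb) (fun z : 'rV[R]_n *
    measurableTypeR R =>
    (ray_weight e z.2)%:E * ball_ind r (delta z.2 z.1)))%E.
    exact: measurable_ray_dilation.
  by move=> z; rewrite mule_ge0// lee_fin ray_weight_ge0.
apply: (@le_lt_trans _ _ (\int[mu_n]_z (C%:E * \int[leb]_mu
     ((ray_weight e mu)%:E * ball_ind r (delta mu z))))%E).
  apply: ge0_le_integral => //.
  - by move=> z _; rewrite lee_fin.
  - exact/measurable_EFinP.
  - by apply: emeasurable_funM => //; exact: measurable_cst.
rewrite ge0_integralZl//.
rewrite (integral_ray_dilation mdelta deltaE)// integral_ray_weightE//.
rewrite lte_mul_pinfty// ?lee_fin// lte_mul_pinfty//.
by rewrite lee_fin invr_ge0; lra.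
Qed.

(** The point [z / mu] is in the unit ball once [mu >= |z|], and the weight [mu ^ (- al - 1)]
    integrated over [[|z|, 2 |z|]] is at least a multiple of [|z| ^ (- al)]. *)
Lemma integral_enorm_tail (al : R) : n%:R < al ->
  (\int[mu_n]_z (if (1 < enorm z)%R then enorm z `^ (- al) else 0)%:E < +oo)%E.
Proof.
move=> nal.
have al0 : 0 < al by rewrite (le_lt_trans _ nal).
have mV : measurable_fun [set: measurableTypeR R] (fun mu : R => mu `^ (-1)).
  exact: measurable_powR.
have mdil := measurable_dilate mV.
apply: (integral_le_ray_lty
  (delta := fun mu z => mu `^ (-1) *: z) (e := - (al +
    1)) (k := n%:R) (r := 1) (C := 2 * 2 `^ al) mdil).
- move=> mu f mu1 mf f0; have mu0 : 0 < mu by lra.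
  have mV0 : 0 < mu `^ (-1) by rewrite powR_gt0.
  transitivity ((`|mu `^ (-1)| ^- n)%:E * \int[mu_n]_x f x)%E.
    rewrite -(integral_affine_rV 0) ?gt_eqF//.
    by apply: eq_integral => x _; rewrite addr0.
  by rewrite gtr0_norm// powR_inv1 ?ltW// exprVn invrK powR_mulrn// ltW.
- lra.
- apply: measurable_fun_ifT => //.
    by apply: measurable_fun_ltr => //; exact: measurable_enorm.
  exact: (measurableT_comp (measurable_powR _) measurable_enorm).
- by move=> z; case: ifP => // _; exact: powR_ge0.
- by rewrite mulr_ge0// powR_ge0.
move=> z.
have g0 mu : (0 <= (ray_weight (- (al +
  1)) mu)%:E * ball_ind 1 (mu `^ (-1) *: z))%E.
  rewrite mule_ge0// ?lee_fin ?ray_weight_ge0//.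
  by rewrite /ball_ind; case: ifP.
case: ifPn => [r1|_]; last first.
  apply: mule_ge0; first by rewrite lee_fin mulr_ge0// powR_ge0.
  by apply: integral_ge0 => mu _; exact: g0.
set r := enorm z in r1 *; have r0 : 0 < r by lra.
(* This is the least value of the weight on [[r, 2 r]]; since [c r = r ^ (- al) / (2 * 2 ^ al)], the
   constant [C] gives equality. *)
pose c := (2 * r)^-1 `^ (al + 1).
apply: (@le_trans _ _ ((2 * 2 `^ al)%:E * (c * (2 * r - r))%:E)%E).
  have x0 : 0 <= (2 * r)^-1 by rewrite invr_ge0; lra.
  have al1 : 0 < al + 1 by lra.
  have p2 : 2 `^ al != 0 by rewrite gt_eqF// powR_gt0.
  have pr : r `^ al != 0 by rewrite gt_eqF// powR_gt0.
  have r_ge0 : 0 <= r by lra.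
  rewrite -EFinM lee_fin /c -(mulr_powRB1 x0 al1) addrK powRVl ?mulr_ge0//.
  rewrite !powRN powRM// le_eqVlt; apply/orP; left; apply/eqP.
  by field; rewrite p2 pr gt_eqF.
apply: lee_pmul => //; rewrite ?lee_fin.
- by rewrite !mulr_ge0 ?powR_ge0//; lra.
apply: integral_ge_segment => //.
- exact: (measurable_ray (delta := fun mu z => mu `^ (-1) *: z) _ _ _ mdil).
- lra.
- by rewrite powR_ge0.
move=> mu /andP[rmu mur]; have mu0 : 0 < mu by lra.
have muN : `|mu `^ (-1)| =
  mu^-1 by rewrite powR_inv1 ?ltW// gtr0_norm// invr_gt0.
rewrite /ray_weight /ball_ind enormZ muN -/r [_ * r]mulrC ler_pdivrMr// mul1r
  rmu ifT; last lra.
rewrite mule1 lee_fin -powRVl ?(ltW mu0)//.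
apply: ge0_ler_powR; rewrite ?nnegrE ?invr_ge0; [lra|lra|lra|].
by rewrite lef_pV2 ?posrE//; lra.
Qed.

(** For [mu] in [[1 / |z|, 2 / |z|]] the point [mu z] is in the ball of radius 2. The weight
    [mu ^ (be - 1)], nondecreasing as [be >= 1], is there at least [|z| ^ (1 - be)], and the length
    [1 / |z|] supplies the missing power. *)
Lemma integral_enorm_core (be : R) : 1 <= be -> be < n%:R ->
  (\int[mu_n]_z (if (enorm z <= 1)%R then enorm z `^ (- be) else 0)%:E < +oo)%E.
Proof.
move=> be1 ben.
have mdil := @measurable_dilate_rV R n.
apply: (integral_le_ray_lty (delta := fun mu z => mu *: z) (e := be - 1) (k :=
  - n%:R) (r := 2) (C := 1) mdil).
- by move=> mu f; exact: integral_dilate_rV.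
- lra.
- apply: measurable_fun_ifT => //.
    by apply: measurable_fun_ler => //; exact: measurable_enorm.
  exact: (measurableT_comp (measurable_powR _) measurable_enorm).
- by move=> z; case: ifP => // _; exact: powR_ge0.
- by [].
move=> z; rewrite mul1e.
have g0 mu : (0 <= (ray_weight (be - 1) mu)%:E * ball_ind 2 (mu *: z))%E.
  rewrite mule_ge0// ?lee_fin ?ray_weight_ge0//.
  by rewrite /ball_ind; case: ifP.
case: ifPn => [r1|_]; last by apply: integral_ge0 => mu _; exact: g0.
set r := enorm z in r1 *.
(* At the origin the integrand is 0, the value of [powR] at base 0 and nonzero exponent. *)
have [r0|r0] := eqVneq r 0.
  rewrite r0 powR0; first by apply: integral_ge0 => mu _; exact: g0.
  by rewrite oppr_eq0 gt_eqF//; lra.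
have {}r0 : 0 < r by rewrite lt_neqAle eq_sym r0 enorm_ge0.
have rV0 : 0 < r^-1 by rewrite invr_gt0.
apply: (@le_trans _ _ (r^-1 `^ (be - 1) * (2 * r^-1 - r^-1))%:E).
  have -> : 2 * r^-1 - r^-1 = r^-1 by ring.
  rewrite [X in (_ <= X%:E)%E]mulrC mulr_powRB1 ?(ltW rV0)//; last lra.
  by rewrite powRVl// ltW.
apply: integral_ge_segment => //.
- exact: (measurable_ray (delta := fun mu z => mu *: z) _ _ _ mdil).
- lra.
- by rewrite powR_ge0.
move=> mu /andP[rmu mur]; have mu0 : 0 < mu by lra.
have rV1 : 1 <= r^-1 by rewrite invf_ge1.
rewrite /ray_weight /ball_ind enormZ (gtr0_norm mu0) -/r -ler_pdivlMr// mur.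
rewrite ifT; last lra.
rewrite mule1 lee_fin.
by apply: ge0_ler_powR; rewrite ?nnegrE; lra.
Qed.
End euclidean_weights.

(** * The balance between the two parts of a derivative along orbits *)

Section balance.
Context {R : realType} {d : measure_display} {T : measurableType d}.
Variable m : {sigma_finite_measure set T -> \bar R}.
Variables (delta : measurableTypeR R -> T -> T) (k : R).
Hypothesis mdelta : measurable_fun setT (fun z : measurableTypeR R * T => delta
  z.1 z.2).
Hypothesis integral_delta : forall mu (f : T -> \bar R), 1 <= mu ->
  measurable_fun setT f -> (forall x, 0 <= f x)%E ->
  (\int[m]_x f (delta mu x) = (mu `^ k)%:E * \int[m]_x f x)%E.
Local Notation leb := (@lebesgue_measure R).
Local Open Scope ereal_scope.

(* Here [p x] is thought of as a function along the orbit of [x] under the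
   dilations, whose derivative at [mu] is [mu `^ e * h (delta mu x)]. *)
Lemma dilation_balance (e : R) (h : T -> R) (p : T -> R -> R) :
  (e + k < -1)%R -> measurable_fun setT h -> measurable_fun setT (p ^~ 1%R) ->
  (forall x, 0 <= p x 1)%R ->
  {ae m, forall x, [/\
    forall mu : R, (1 <= mu)%R ->
      is_derive mu 1%R (p x) (mu `^ e * h (delta mu x))%R,
    forall mu : R, (1 <= mu)%R ->
      {for mu, continuous (fun u => h (delta u x))} &
    p x mu @[mu --> +oo%R] --> (0%R : R)]} ->
  (- (e + k + 1))^-1%:E * \int[m]_x (Num.max (- h x) 0)%:E =
  \int[m]_x (p x 1)%:E + (- (e + k + 1))^-1%:E * \int[m]_x (Num.max (h x) 0)%:E.
Proof.
move=> ek mh mp p0 aep.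
have mmax (g : T -> R) : measurable_fun setT g ->
    measurable_fun setT (fun x => (Num.max (g x) 0)%:E).
  by move=> mg; apply/measurable_EFinP; apply: measurable_maxr.
have mhN : measurable_fun setT (fun x => - h x)%R by exact: measurable_funN.
have max0 (g : T -> R) x : 0 <= (Num.max (g x) 0)%:E.
  by rewrite lee_fin le_max lexx orbT.
have int0 (g : T -> R) x : 0 <= \int[leb]_mu
    ((ray_weight e mu)%:E * (Num.max (g (delta mu x)) 0)%:E).
  by apply: integral_ge0 => mu _; rewrite mule_ge0// lee_fin ray_weight_ge0.
have mint (g : T -> R) : measurable_fun setT g ->
    measurable_fun setT (fun x => \int[leb]_mu
      ((ray_weight e mu)%:E * (Num.max (g (delta mu x)) 0)%:E)).
  move=> mg; apply: (measurable_fun_fubini_tonelli_F (m2 := leb)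
    (fun z : T * measurableTypeR R =>
    (ray_weight e z.2)%:E * (Num.max (g (delta z.2 z.1)) 0)%:E))%E.
    exact: (measurable_ray_dilation mdelta e (mmax _ mg)).
  by move=> z; rewrite mule_ge0// lee_fin ray_weight_ge0.
rewrite -(integral_ray_weightE ek).
have dilE (g : T -> R) (mg : measurable_fun setT g) :=
  integral_ray_dilation mdelta integral_delta e (mmax g mg) (max0 g).
rewrite -(dilE _ mhN) -(dilE _ mh) -ge0_integralD//; last 3 first.
- by move=> x _; rewrite lee_fin.
- exact/measurable_EFinP.
- exact: (mint h).
(* Both sides are now integrals over [T]; they agree at almost every [x] by the fundamental theorem
   along the orbit of [x]. *)
apply: ge0_ae_eq_integral => //.
- exact: (mint (fun x => - h x)%R).
- by apply: emeasurable_funD; [exact/measurable_EFinP|exact: (mint h)].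
- by move=> x _; exact: (int0 (fun x => - h x)%R).
- by move=> x _; apply: adde_ge0; [rewrite lee_fin|exact: (int0 h)].
apply: filterS aep => x [dp ch px0] _.
rewrite !integral_ray_weight.
have cq (mu : R) : (1 <= mu)%R ->
    {for mu, continuous (fun u => u `^ e * h (delta u x))%R}.
  move=> mu1; have mu0 : (0 < mu)%R by lra.
  apply: continuousM; last exact: ch.
  apply/differentiable_continuous/derivable1_diffP.
  by apply: derivable_powR; rewrite in_itv/= mu0.
have := FTC_ray_pos_neg dp cq px0.
have maxM (mu : R) (g : R) : (mu `^ e * Num.max g 0 =
  Num.max (mu `^ e * g) 0)%R.
  by rewrite maxr_pMr ?powR_ge0// mulr0.
under eq_integral do rewrite -mulrN -maxM EFinM.
by under [in RHS]eq_integral do rewrite -maxM EFinM.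
Qed.

End balance.

(** * Pairs of points and their dilations *)

Section pair_measure.
Context {R : realType} {n : nat}.

(** The product measure is packed with its sigma-finiteness so that [dilation_balance] applies to
    pairs. *)
Definition lebesgue_pair :
    {sigma_finite_measure set ('rV[R]_n * 'rV[R]_n)%type -> \bar R} :=
  HB.pack (lebesgue_rV R n \x lebesgue_rV R n)%E
    (Measure_isSigmaFinite.Build _ _ _ _
      (product_sigma_finite (lebesgue_rV R n) (lebesgue_rV R n))).

Definition dilate_pair (mu : measurableTypeR R) (z : 'rV[R]_n * 'rV[R]_n) :=
  (mu *: z.1, mu *: z.2).

Lemma measurable_dilate_pair : measurable_fun setT
  (fun w : measurableTypeR R * ('rV[R]_n * 'rV[R]_n) => dilate_pair w.1 w.2).
Proof.
pose f1 (w : measurableTypeR R * ('rV[R]_n * 'rV[R]_n)) := (w.1, w.2.1).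
pose f2 (w : measurableTypeR R * ('rV[R]_n * 'rV[R]_n)) := (w.1, w.2.2).
have mf1 : measurable_fun setT f1.
  apply: measurable_fun_pair => //.
  exact: (measurableT_comp measurable_fst measurable_snd).
have mf2 : measurable_fun setT f2.
  apply: measurable_fun_pair => //.
  exact: (measurableT_comp measurable_snd measurable_snd).
apply: measurable_fun_pair.
  exact: (measurableT_comp measurable_dilate_rV mf1).
exact: (measurableT_comp measurable_dilate_rV mf2).
Qed.

Local Open Scope ereal_scope.

Lemma integral_lebesgue_pair (f : 'rV[R]_n * 'rV[R]_n -> \bar R) :
  measurable_fun setT f -> (forall z, 0 <= f z) ->
  \int[lebesgue_pair]_z f z =
  \int[lebesgue_rV R n]_x \int[lebesgue_rV R n]_y f (x, y).
Proof. by move=> mf f0; exact: fubini_tonelli1. Qed.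

Lemma integral_dilate_pair (mu : R) (f : 'rV[R]_n * 'rV[R]_n -> \bar R) :
  (1 <= mu)%R -> measurable_fun setT f -> (forall x, 0 <= f x) ->
  \int[lebesgue_pair]_z f (dilate_pair mu z) =
  (mu `^ (- (2 * n%:R)))%:E * \int[lebesgue_pair]_z f z.
Proof.
move=> mu1 mf f0; have mu0 : (0 < mu)%R by lra.
have mpair : measurable_fun setT
    (fun z : 'rV[R]_n * 'rV[R]_n => (mu, z) : measurableTypeR R * _).
  by apply: measurable_fun_pair.
have mfx x : measurable_fun setT (fun y => f (x, y)).
  by apply: (measurableT_comp mf); exact: measurable_fun_pair.
rewrite !integral_lebesgue_pair//; last first.
  exact: (measurableT_comp mf (measurableT_comp measurable_dilate_pair mpair)).
rewrite /dilate_pair/=.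
under eq_integral do rewrite (integral_dilate_rV mu1 (mfx _))//.
have mF : measurable_fun setT
    (fun x => \int[lebesgue_rV R n]_y f (x, y)).
  exact: measurable_fun_fubini_tonelli_F.
have F0 x : 0 <= \int[lebesgue_rV R n]_y f (x, y) by exact: integral_ge0.
rewrite ge0_integralZl//; last 2 first.
- have mcst : measurable_fun setT
      (fun x : 'rV[R]_n => (mu, x) : measurableTypeR R * _).
    exact: measurable_fun_pair.
  exact: (measurableT_comp mF (measurableT_comp measurable_dilate_rV mcst)).
- by rewrite lee_fin powR_ge0.
rewrite (integral_dilate_rV mu1 mF)// muleA -EFinM -powRD.
  by congr (_ * _); congr ((_ `^ _)%:E); ring.
by apply/implyP => _; rewrite gt_eqF.
Qed.

(** The origin is a box with sides of length 0; in dimension 0 it would have mass 1. *)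
Lemma lebesgue_rV_set0 : (0 < n)%N -> lebesgue_rV R n [set 0%R] = 0.
Proof.
case: n => // k _.
rewrite (_ : [set 0%R] = [set x : 'rV[R]_k.+1 | forall i,
  [set (0%R : measurableTypeR R)] (x ord0 i)]).
  rewrite (lebesgue_rV_box (A := fun=> [set (0%R : measurableTypeR R)]))//.
  by rewrite big_ord_recl lebesgue_measure_set1 mul0e.
apply/seteqP; split=> x /=; first by move=> -> i; rewrite mxE.
by move=> x0; apply/rowP => i; rewrite mxE x0.
Qed.

Lemma measurable_rV_set0 : measurable [set 0%R : 'rV[R]_n].
Proof.
rewrite (_ : [set 0%R] = [set z : 'rV[R]_n | (enorm z <= 0)%R]).
  exact: (measurable_enorm_ball 0%R).
apply/seteqP; split=> z /=.
  by move=> ->; rewrite -(scale0r 0%R) enormZ normr0 mul0r.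
by move=> z0; apply: enorm_eq0; apply/eqP; rewrite eq_le z0 enorm_ge0.
Qed.

(** The orbit of the origin is constant, so nothing decays along it; it is discarded as a null
    set. *)
Lemma ae_rV_neq0 : (0 < n)%N -> {ae lebesgue_rV R n, forall x, x != 0%R}.
Proof.
move=> n0; exists [set 0%R]; split => //=.
- exact: measurable_rV_set0.
- exact: lebesgue_rV_set0.
- by move=> x /= /negP; rewrite negbK => /eqP.
Qed.

Lemma ae_pair_neq0 : (0 < n)%N ->
  {ae lebesgue_pair, forall z, z.1 != 0%R /\ z.2 != 0%R}.
Proof.
move=> n0; have m0 := measurable_rV_set0.
exists (([set 0%R] `*` setT) `|` (setT `*` [set 0%R])); split => //=.
- by apply: measurableU; exact: measurableX.
- have e0 := lebesgue_rV_set0 n0.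
  rewrite measureU0; [|exact: measurableX|exact: measurableX|].
    rewrite /= product_measure1E//; apply/eqP; rewrite mule_eq0; apply/orP;
      left.
    exact/eqP.
  rewrite /= product_measure1E//; apply/eqP; rewrite mule_eq0; apply/orP; right.
  exact/eqP.
- move=> [x y] /= /not_andP[] /negP; rewrite negbK => /eqP ->.
    by left.
  by right.
Qed.

End pair_measure.

(** * The bubble and [psi] as polynomials in one profile *)

Section bubble_profile.
Context {R : realType} {n : nat}.
Implicit Types x y : 'rV[R]_n.

(** This is the [v] of the overview; in terms of it, [U] and [psi] have natural exponents. *)
Definition profile x : R := (Num.sqrt (1 + enorm x ^+ 2))^-1.

Lemma jsq_ge1 x : 1 <= 1 + enorm x ^+ 2.
Proof. by rewrite lerDl sqr_ge0. Qed.

Lemma jsq_gt0 x : 0 < 1 + enorm x ^+ 2.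
Proof. exact: lt_le_trans ltr01 (jsq_ge1 x). Qed.

Lemma profile_gt0 x : 0 < profile x.
Proof. by rewrite invr_gt0 sqrtr_gt0 jsq_gt0. Qed.

Lemma sqr_profile x : profile x ^+ 2 = (1 + enorm x ^+ 2)^-1.
Proof. by rewrite exprVn sqr_sqrtr// (ltW (jsq_gt0 x)). Qed.

Lemma profile_le1 x : profile x <= 1.
Proof.
rewrite invf_le1 ?sqrtr_gt0 ?jsq_gt0//.
by rewrite -[leLHS]sqrtr1 ler_wsqrtr// jsq_ge1.
Qed.

Lemma profile_powR x (k : nat) :
  profile x ^+ k = (1 + enorm x ^+ 2) `^ (- (k%:R / 2)).
Proof.
have t0 := jsq_gt0 x.
rewrite /profile -powR12_sqrt ?(ltW t0)// -powRN -powR_mulrn ?powR_ge0//.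
by rewrite -powRrM mulNr mulrC.
Qed.

(** The vectors [p (1, x)] and [q (1, y)] have norm 1 in dimension [n + 1], so their inner product
    is at most 1. This makes [(p q)^2 |x - y|^2] at least [(p - q)^2], and [p q <= 1]. *)
Lemma profile_lipschitz x y : `|profile x - profile y| <= enorm (x - y).
Proof.
set p := profile x; set q := profile y.
have p0 : 0 < p := profile_gt0 x; have q0 : 0 < q := profile_gt0 y.
have p1 : p ^+ 2 <= 1 by rewrite expr_le1 ?(ltW p0) ?profile_le1.
have q1 : q ^+ 2 <= 1 by rewrite expr_le1 ?(ltW q0) ?profile_le1.
have pE : p ^+ 2 * (1 + enorm x ^+ 2) =
  1 by rewrite sqr_profile mulVf ?gt_eqF ?jsq_gt0.
have qE : q ^+ 2 * (1 + enorm y ^+ 2) =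
  1 by rewrite sqr_profile mulVf ?gt_eqF ?jsq_gt0.
have distE : enorm (x - y) ^+ 2 = enorm x ^+ 2 + enorm y ^+ 2 - 2 * dotrV x y.
  rewrite !sqr_enorm /dotrV mulr_sumr -big_split/= -sumrB.
  by apply: eq_bigr => i _; rewrite !mxE; ring.
have dotE : \sum_(i < n) (p * x ord0 i - q * y ord0 i) ^+ 2 =
    p ^+ 2 * enorm x ^+ 2 + q ^+ 2 * enorm y ^+ 2 - 2 * p * q * dotrV x y.
  rewrite !sqr_enorm /dotrV !mulr_sumr -big_split/= -sumrB.
  by apply: eq_bigr => i _; ring.
have dot1 : p * q * (1 + dotrV x y) <= 1.
  have : 0 <= \sum_(i < n) (p * x ord0 i - q * y ord0 i) ^+ 2.
    by apply: sumr_ge0 => i _; rewrite sqr_ge0.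
  have := sqr_ge0 (p - q).
  rewrite dotE; nra.
rewrite -(@ler_pXn2r _ 2) ?nnegrE ?enorm_ge0// real_normK ?num_real//.
have pq0 : 0 < p * q by exact: mulr_gt0.
have le1 : (p - q) ^+ 2 <= (p * q) ^+ 2 * enorm (x - y) ^+ 2.
  rewrite distE.
  have -> : (p * q) ^+ 2 * (enorm x ^+ 2 + enorm y ^+ 2 - 2 * dotrV x y) =
    q ^+ 2 * (p ^+ 2 * (1 + enorm x ^+ 2)) + p ^+ 2 * (q ^+ 2 * (1 +
      enorm y ^+ 2))
    - 2 * (p * q) * (p * q * (1 + dotrV x y)) by ring.
  rewrite pE qE; nra.
apply: (le_trans le1); rewrite ler_piMl ?sqr_ge0//.
by rewrite exprMn mulr_ile1 ?sqr_ge0.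
Qed.

Lemma measurable_profile : measurable_fun setT profile.
Proof.
have mt : measurable_fun setT (fun x => 1 + enorm x ^+ 2).
  by apply: measurable_funD => //; apply: measurable_funX;
    exact: measurable_enorm.
rewrite (_ : profile = fun x => (1 + enorm x ^+ 2) `^ (- (1 / 2))).
  exact: (measurableT_comp (measurable_powR _) mt).
by apply/funext => x; rewrite -[LHS]expr1 profile_powR.
Qed.

Lemma bubble_profile x : (2 < n)%N -> bubble x = profile x ^+ (n - 2).
Proof.
by move=> n2; rewrite profile_powR /bubble natrB// ltnW.
Qed.

Lemma derive_line (V : normedModType R) (f : V -> R) (a v : V) :
  'D_v f a = derive1 (fun h : R => f (h *: v + a)) 0.
Proof.
by rewrite /derive /derive1 /=;
  under [in RHS]eq_fun do rewrite /= addr0 scale0r add0r.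
Qed.

(** Along the [i]-th axis [1 + |x|^2] is a quadratic polynomial in the increment, so the
    one-variable chain rule suffices. *)
Lemma gradrV_bubble x i : gradrV (@bubble R n) x ord0 i =
  - (n%:R - 2) * (1 + enorm x ^+ 2) `^ (- (n%:R / 2)) * x ord0 i.
Proof.
rewrite mxE derive_line.
have -> : (fun h : R => bubble (h *: delta_mx ord0 i + x)) =
    (fun h : R => (1 + enorm x ^+ 2 + 2 * h * x ord0 i + h ^+ 2) `^
      (- ((n%:R - 2) / 2))).
  apply/funext => h; rewrite /bubble; congr (_ `^ _).
  rewrite !sqr_enorm (bigD1 i)//= [in RHS](bigD1 i)//= !mxE !eqxx mulr1.
  under eq_bigr => j ji.
    by rewrite !mxE (negbTE ji) andbF mulr0 add0r over.
  by ring.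
set t := 1 + enorm x ^+ 2; have t0 : 0 < t := jsq_gt0 x.
rewrite derive1E.
pose g (h : R) := t + 2 * h * x ord0 i + h ^+ 2.
have dg : is_derive (0 : R) 1 g (2 * x ord0 i).
  by rewrite /g; apply: is_derive_eq; rewrite /GRing.scale/=; ring.
have g0 : g 0 = t by rewrite /g; ring.
have dp : is_derive (g 0) 1 ((@powR R)^~ (- ((n%:R - 2) / 2)))
    (- ((n%:R - 2) / 2) * t `^ (- ((n%:R - 2) / 2) - 1)).
  by rewrite g0; exact: is_derive1_powR.
have := is_derive1_comp dp dg.
rewrite /comp /g => dgp; rewrite (derive_val (is_derive := dgp)).
have -> : - ((n%:R - 2) / 2) - 1 = - (n%:R / 2) :> R by field.
by field.
Qed.

Lemma bubble_psiE x : bubble_psi x = (n%:R - 2) / 2 *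
  ((1 - enorm x ^+ 2) / (1 + enorm x ^+ 2) `^ (n%:R / 2)).
Proof.
rewrite /bubble_psi {1}/dotrV.
under eq_bigr do rewrite gradrV_bubble.
have -> : \sum_(i < n) x ord0 i * (- (n%:R - 2) *
    (1 + enorm x ^+ 2) `^ (- (n%:R / 2)) * x ord0 i) =
    - (n%:R - 2) * (1 + enorm x ^+ 2) `^ (- (n%:R / 2)) * enorm x ^+ 2.
  by rewrite sqr_enorm mulr_sumr; apply: eq_bigr => i _; ring.
(* Writing [U] as [t * t ^ (- n / 2)], with [t = 1 + |x|^2], gives both terms of [psi] a common
   factor. *)
have -> : bubble x = (1 + enorm x ^+ 2) * (1 + enorm x ^+ 2) `^ (- (n%:R / 2)).
  rewrite -[X in X * _](powRr1 (ltW (jsq_gt0 x))) -powRD.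
    by rewrite /bubble; congr (_ `^ _); field.
  by apply/implyP => _; rewrite gt_eqF ?jsq_gt0.
by rewrite (powRN _ (n%:R / 2)); field; rewrite gt_eqF ?powR_gt0 ?jsq_gt0.
Qed.

Lemma bubble_psi_profile x : (2 < n)%N ->
  bubble_psi x = (n%:R - 2) / 2 * (2 * profile x ^+ n - profile x ^+ (n - 2)).
Proof.
move=> n2; rewrite bubble_psiE -powRN -profile_powR; congr (_ * _).
have -> : profile x ^+ n = profile x ^+ (n - 2) * (1 + enorm x ^+ 2)^-1.
  by rewrite -sqr_profile -exprD subnK// ltnW.
by field; rewrite gt_eqF ?jsq_gt0.
Qed.

End bubble_profile.

(** * The profile along orbits, its decay and its integrability *)

Section profile_dilation.
Context {R : realType} {n : nat}.
Implicit Types x : 'rV[R]_n.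

Lemma profile_jsq x : profile x ^+ 2 * (1 + enorm x ^+ 2) = 1.
Proof. by rewrite sqr_profile mulVf// gt_eqF ?jsq_gt0. Qed.

(** The chain rule gives [- mu |x|^2 v^3]; the relation [v^2 (1 + mu^2 |x|^2) = 1] turns it into
    [mu^-1] times a polynomial in [v]. *)
Lemma is_derive_profile x (mu : R) : 0 < mu ->
  is_derive mu 1 (fun u : R => profile (u *: x))
    (mu^-1 * (profile (mu *: x) ^+ 3 - profile (mu *: x))).
Proof.
move=> mu0; set r := enorm x ^+ 2.
pose g (u : R) := 1 + u ^+ 2 * r.
have gE u : g u = 1 + enorm (u *: x) ^+ 2.
  by rewrite enormZ exprMn real_normK ?num_real.
have g0 : 0 < g mu by rewrite gE jsq_gt0.
have profileE : (fun u : R => profile (u *: x)) = (@powR R)^~ (- 2^-1) \o g.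
  apply/funext => u /=; rewrite -[LHS]expr1 profile_powR gE.
  by congr (_ `^ _); field.
have dg : is_derive mu 1 g (2 * mu * r).
  by rewrite /g; apply: is_derive_eq; rewrite /GRing.scale/=; ring.
have dp := is_derive1_powR (- 2^-1) g0.
have := is_derive1_comp dp dg; rewrite -profileE => dfg.
apply: (is_derive_eq dfg).
have -> : g mu `^ (- 2^-1 - 1) = profile (mu *: x) ^+ 3.
  by rewrite profile_powR gE; congr (_ `^ _); field.
have := profile_jsq (mu *: x); rewrite -gE.
set v := profile _ => vg.
have -> : v ^+ 3 - v = v ^+ 3 - v * (v ^+ 2 * g mu) by rewrite vg mulr1.
by rewrite /g; field; rewrite gt_eqF.
Qed.

Lemma is_derive_profileX x (mu : R) (k : nat) : 0 < mu ->
  is_derive mu 1 (fun u : R => profile (u *: x) ^+ k)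
    (mu^-1 * (k%:R * (profile (mu *: x) ^+ k.+2 - profile (mu *: x) ^+ k))).
Proof.
move=> mu0.
have -> : (fun u : R => profile (u *: x) ^+ k) =
  (fun u => profile (u *: x)) ^+ k.
  by apply/funext => u; elim: k => [|k IHk]; rewrite ?expr0// !exprS IHk.
apply: (is_derive_eq (is_deriveX k (is_derive_profile x mu0))).
case: k => [|k]; rewrite ?mul0r ?scale0r ?mulr0//= !exprS /GRing.scale/=.
by ring.
Qed.

Lemma continuous_profileX x (mu : R) (k : nat) : 0 < mu ->
  {for mu, continuous (fun u : R => profile (u *: x) ^+ k)}.
Proof.
move=> /(is_derive_profileX x k)[dp _].
exact/differentiable_continuous/derivable1_diffP.
Qed.

(** The quantity is [mu / (1 + mu^2 |x|^2)], hence at most [1 / (mu |x|^2)]. Both decay conditions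
    required by the balance below reduce to it. *)
Lemma cvg_profile x : x != 0 ->
  (mu : R) * profile (mu *: x) ^+ 2 @[mu --> +oo] --> (0 : R).
Proof.
move=> x0; set r := enorm x ^+ 2.
have r0 : 0 < r.
  by rewrite exprn_even_gt0//=; apply: contra x0 => /eqP/enorm_eq0/eqP.
apply/cvgr0Pnorm_le => _/posnumP[eps]; near=> mu.
have mu1 : 1 <= mu by near: mu; apply: nbhs_pinfty_ge; exact: num_real.
have mur : (r * eps%:num)^-1 <= mu.
  by near: mu; apply: nbhs_pinfty_ge; exact: num_real.
have mu0 : 0 < mu by lra.
rewrite ger0_norm; last by rewrite mulr_ge0 ?sqr_ge0 ?(ltW mu0).
rewrite sqr_profile enormZ exprMn real_normK ?num_real// -/r.
have t0 : 0 < 1 + mu ^+ 2 * r by rewrite ltr_pwDl// mulr_ge0 ?sqr_ge0 ?(ltW r0).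
rewrite ler_pdivrMr//.
have : 1 <= mu * (r * eps%:num).
  by rewrite -ler_pdivrMr ?div1r// mulr_gt0.
have e0 : 0 < eps%:num by [].
move: (eps%:num) e0 => e e0 h; nra.
Unshelve. all: by end_near. Qed.

(** [profile] is at most 1 in the unit ball and at most [1 / |x|] outside, which reduces the claim
    to [integral_enorm_tail]. *)
Lemma integrable_profile (k : nat) : (n < k)%N ->
  (lebesgue_rV R n).-integrable setT (fun x => (profile x ^+ k)%:E).
Proof.
move=> nk.
apply/integrableP; split.
  by apply/measurable_EFinP; apply: measurable_funX; exact: measurable_profile.
pose h x : R := (\1_[set z : 'rV[R]_n | enorm z <= 1] x : R).
pose tl x : R := if 1 < enorm x then enorm x `^ (- k%:R) else 0.
have tl0 x : 0 <= tl x by rewrite /tl; case: ifP => // _; exact: powR_ge0.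
have mtl : measurable_fun setT tl.
  apply: measurable_fun_ifT => //.
    by apply: measurable_fun_ltr => //; exact: measurable_enorm.
  exact: (measurableT_comp (measurable_powR _) measurable_enorm).
have mh : measurable_fun setT h.
  by apply: measurable_indic; exact: measurable_enorm_ball.
apply: (@le_lt_trans _ _ (\int[lebesgue_rV R n]_x ((h x)%:E + (tl x)%:E))%E).
  apply: ge0_le_integral => //.
  - apply/measurableT_comp => //; apply/measurable_EFinP.
    by apply: measurable_funX; exact: measurable_profile.
  - by apply: emeasurable_funD; exact/measurable_EFinP.
  move=> x _; rewrite /= -EFinD lee_fin ger0_norm ?exprn_ge0 ?(ltW (profile_gt0
    x))//.
  rewrite /h /tl indicE; case: ltP => x1.
    rewrite memNset ?add0r; last by move=> /=; rewrite leNgt x1.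
    have e0 : 0 < enorm x by lra.
    rewrite powR_invn ?(ltW e0)// -exprVn.
    rewrite lerXn2r ?nnegrE ?invr_ge0 ?(ltW e0) ?(ltW (profile_gt0 x))//.
    rewrite lef_pV2; last 2 first.
    - by rewrite posrE sqrtr_gt0 jsq_gt0.
    - by rewrite posrE.
    apply: (@le_trans _ _ (Num.sqrt (enorm x ^+ 2))).
      by rewrite sqrtr_sqr ger0_norm ?(ltW e0).
    by rewrite ler_wsqrtr// lerDr.
  by rewrite mem_set// addr0 exprn_ile1 ?profile_le1 ?(ltW (profile_gt0 x)).
rewrite ge0_integralD//; last 4 first.
- by move=> x _; rewrite lee_fin /h indicE ler0n.
- exact/measurable_EFinP.
- by move=> x _; rewrite lee_fin.
- exact/measurable_EFinP.
rewrite lte_add_pinfty//.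
  rewrite integral_indic ?setIT//; last exact: measurable_enorm_ball.
  exact: lebesgue_rV_ball_lty.
by apply: integral_enorm_tail; rewrite ltr_nat.
Qed.

End profile_dilation.

(** Were the integral 0, [f] would vanish almost everywhere, and [A] would lie in a null set. *)
Lemma integral_gt0_subset {R : realType} {d} {T : measurableType d}
    (m : {measure set T -> \bar R}) (f : T -> \bar R) (A : set T) :
  measurable_fun setT f -> (forall x, 0 <= f x)%E -> measurable A ->
  (0 < m A)%E -> (forall x, A x -> 0 < f x)%E -> (0 < \int[m]_x f x)%E.
Proof.
move=> mf f0 mA A0 fA; rewrite lt_neqAle integral_ge0// andbT eq_sym.
apply/eqP => int0; move: A0; rewrite lt_neqAle => /andP[/eqP + _]; apply.
have : ae_eq m setT f (cst 0%E).
  apply/(ae_eq_integral_abs m measurableT mf).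
  by rewrite -int0; apply: eq_integral => x _; rewrite gee0_abs.
move=> [B [mB B0 AB]].
apply/esym/eqP; rewrite -measure_le0 -B0; apply: le_measure; rewrite ?inE//.
move=> x Ax; apply: AB => /= /(_ I) fx0.
by have := fA _ Ax; rewrite fx0 ltxx.
Qed.

(** * The vanishing integral behind the first inequality *)

Section first_integral.
Context {R : realType} {n : nat}.
Local Notation mu_n := (lebesgue_rV R n).
Implicit Types x : 'rV[R]_n.

Let v_ge0 x : 0 <= profile x := ltW (profile_gt0 x).

Lemma sqr_profile_le1 x : profile x ^+ 2 <= 1.
Proof. by rewrite expr_le1 ?profile_le1. Qed.

(** This is the vanishing of the integral of [(t - 2) t ^ (- n - 1)]. Along an orbit [v ^ (2 n)] has
    derivative [mu^-1 h] with [h <= 0], so the balance with [e = -1] and [k = - n] has no positive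
    part. *)
Lemma Rintegral_profile_double : (0 < n)%N ->
  \int[mu_n]_x (profile x ^+ (2 * n)) =
  2 * \int[mu_n]_x (profile x ^+ (2 * n).+2).
Proof.
move=> n0.
have ltn2n : (n < 2 * n)%N by rewrite mul2n -addnn -subn_gt0 addnK.
have nR : 0 < n%:R :> R by rewrite ltr0n.
pose h x := (2 * n)%:R * (profile x ^+ (2 * n).+2 - profile x ^+ (2 * n)).
have i0 : mu_n.-integrable setT (EFin \o (fun x => profile x ^+ (2 * n))).
  by apply: integrable_profile; exact: ltn2n.
have i2 : mu_n.-integrable setT (EFin \o (fun x => profile x ^+ (2 * n).+2)).
  by apply: integrable_profile; rewrite !leqW.
have mX k : measurable_fun setT (fun x => profile x ^+ k).
  by apply: measurable_funX; exact: measurable_profile.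
have h0 x : h x <= 0.
  rewrite /h mulr_ge0_le0 ?ler0n// subr_le0.
  by rewrite -addn2 exprD ler_piMr ?exprn_ge0// sqr_profile_le1.
have eE : - (- 1 - n%:R + 1) = n%:R :> R by ring.
have mh : measurable_fun setT h.
  by apply: measurable_funM => //; apply: measurable_funB; exact: mX.
have : (n%:R^-1%:E * \int[mu_n]_x (Num.max (- h x) 0)%:E =
    \int[mu_n]_x (profile (1%R *: x) ^+ (2 * n))%:E +
    n%:R^-1%:E * \int[mu_n]_x (Num.max (h x) 0)%:E)%E.
  rewrite -[X in (X^-1)%R]eE; apply: (@dilation_balance R _ _ mu_n
    (fun mu x => mu *: x) (- n%:R) measurable_dilate_rV
    (@integral_dilate_rV R n) (- 1) h
    (fun x u => profile (u *: x) ^+ (2 * n))) => //.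
  - by lra.
  - by under eq_fun do rewrite scale1r; exact: mX.
  - by move=> x; rewrite exprn_ge0.
  apply: filterS (ae_rV_neq0 n0) => x x0; split.
  - move=> mu mu1; have mu0 : 0 < mu by lra.
    by rewrite powR_inv1 ?(ltW mu0)//; exact: is_derive_profileX.
  - move=> mu mu1; have mu0 : 0 < mu by lra.
    apply: continuousM; first exact: cvg_cst.
    by apply: continuousB; exact: continuous_profileX.
  (* For [mu >= 1], [v ^ (2 n) <= v ^ 2 <= mu v ^ 2]. *)
  - apply: (@squeeze_cvgr _ _ _ _ (fun=> 0) (fun mu : R => mu * profile (mu *:
    x) ^+ 2)); last 2 first.
    + exact: cvg_cst.
    + exact: cvg_profile.
    near=> mu; rewrite exprn_ge0//=.
    have mu1 : 1 <= mu by near: mu; apply: nbhs_pinfty_ge; exact: num_real.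
    rewrite exprM; apply: (@le_trans _ _ (profile (mu *: x) ^+ 2)).
      by rewrite ler_iXnr ?sqr_ge0 ?sqr_profile_le1.
    by rewrite ler_peMl ?sqr_ge0.
have -> : (\int[mu_n]_x (Num.max (h x) 0)%:E = 0)%E.
  by apply: integral0_eq => x _; rewrite max_r.
rewrite mule0 adde0.
under eq_integral do rewrite max_l ?oppr_ge0//.
under [in RHS]eq_integral do rewrite scale1r.
have hE x : (- h x)%:E = ((2 * n)%:R%:E *
    ((profile x ^+ (2 * n))%:E - (profile x ^+ (2 * n).+2)%:E))%E.
  by rewrite -EFinB -EFinM; congr EFin; rewrite /h; ring.
under eq_integral do rewrite hE.
rewrite integralZl//; last exact: integrableB.
rewrite integralB//.
have f0 := integrable_fin_num measurableT i0.
have f2 := integrable_fin_num measurableT i2.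
rewrite /Rintegral; move: f0 f2 => /=.
case: (\int[mu_n]_x _)%E => [A| |]// _; case: (\int[mu_n]_x _)%E => [B| |]// _.
rewrite -EFinB -!EFinM => -[]; rewrite natrM mulrA mulrCA mulVf ?gt_eqF// mulr1.
by move=> /= ?; lra.
Unshelve. all: by end_near. Qed.

End first_integral.

Lemma lebesgue_rV_cube_gt0 {R : realType} n (a b : R) : a < b ->
  (0 < lebesgue_rV R n (cube a b))%E.
Proof. by move=> ab; rewrite lebesgue_rV_cube// lte_fin exprn_gt0// subr_gt0.
  Qed.

(** * The sign of the first integral *)

Section first_integral_sign.
Context {R : realType} {n : nat}.
Local Notation mu_n := (lebesgue_rV R n).
Implicit Types x : 'rV[R]_n.

Let v_ge0 x : 0 <= profile x := ltW (profile_gt0 x).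

(** [U ^ p1] is [v ^ (n + 2)], because [(n - 2) / 2] times [p1] is [(n + 2) / 2]; the minus sign of
    [ln U] is absorbed into [psi]. *)
Lemma first_integrandE x : (2 < n)%N ->
  ln (bubble x) * bubble x `^ critical_exponent R n * bubble_psi x =
  ((n%:R - 2) / 2) ^+ 2 * (ln (1 + enorm x ^+ 2) *
    (profile x ^+ (2 * n) - 2 * profile x ^+ (2 * n).+2)).
Proof.
move=> n2; rewrite bubble_psi_profile// /bubble ln_powR -powRrM.
have n20 : n%:R - 2 != 0 :> R by rewrite subr_eq0 eqr_nat gtn_eqF.
have -> : - ((n%:R - 2) / 2) * critical_exponent R n = - ((n + 2)%:R / 2).
  by rewrite /critical_exponent natrD; field.
rewrite -profile_powR.
have -> : profile x ^+ (2 * n) = profile x ^+ (n + 2) * profile x ^+ (n - 2).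
  by rewrite -exprD addnBA ?(ltnW n2)// addnAC addnK addnn mul2n.
have -> : profile x ^+ (2 * n).+2 = profile x ^+ (n + 2) * profile x ^+ n.
  by rewrite -exprD addnAC addnn mul2n addn2.
by ring.
Qed.

(** This is [(t - 2) t ^ (- n - 1)]: the powers of [profile] serve to integrate it, the form in [DE]
    shows its sign. *)
Let D x : R := profile x ^+ (2 * n) - 2 * profile x ^+ (2 * n).+2.

Let DE x : D x = profile x ^+ (2 * n).+2 * (1 + enorm x ^+ 2 - 2).
Proof.
rewrite /D; have := profile_jsq x; rewrite -[(2 * n).+2]addn2 exprD.
move: (_ + _) => t vt.
transitivity (profile x ^+ (2 * n) * (profile x ^+ 2 * t) -
  2 * (profile x ^+ (2 * n) * profile x ^+ 2)); last by ring.
by rewrite vt mulr1.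
Qed.

Let measurable_D : measurable_fun setT D.
Proof.
have mX k : measurable_fun setT (fun x => profile x ^+ k).
  by apply: measurable_funX; exact: measurable_profile.
by apply: measurable_funB => //; apply: measurable_funM.
Qed.

Let measurable_ln_jsq : measurable_fun setT (fun x => ln (1 + enorm x ^+ 2)).
Proof.
apply: (measurableT_comp (@measurable_ln R)).
by apply: measurable_funD => //; apply: measurable_funX;
  exact: measurable_enorm.
Qed.

Let D_le x : `|D x| <= profile x ^+ (2 * n).
Proof.
have -> : D x = profile x ^+ (2 * n) * (1 - 2 * profile x ^+ 2).
  by rewrite /D -[(2 * n).+2]addn2 exprD; ring.
have v2 := sqr_profile_le1 x; have v0 := sqr_ge0 (profile x).
rewrite normrM ger0_norm ?exprn_ge0// ler_piMr ?exprn_ge0//.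
by rewrite ler_norml; apply/andP; split; lra.
Qed.

Let integrable_D : (2 < n)%N -> mu_n.-integrable setT (EFin \o D).
Proof.
move=> n2; apply: (le_integrable measurableT _ _ (integrable_profile (k := 2 *
  n) _)).
- exact/measurable_EFinP.
- by move=> x _; rewrite /= lee_fin [leRHS]ger0_norm ?exprn_ge0.
- by rewrite mul2n -addnn -subn_gt0 addnK; exact: leq_trans n2.
Qed.

(** As [ln t <= t] and [v^2 t = 1], the logarithm costs two powers of [v], and [2 n - 2 > n]. *)
Let integrable_lnD : (2 < n)%N ->
  mu_n.-integrable setT (EFin \o (fun x => ln (1 + enorm x ^+ 2) * D x)).
Proof.
move=> n2; apply: (le_integrable measurableT _ _ (integrable_profile (k := 2 *
  n - 2) _)).
- by apply/measurable_EFinP; apply: measurable_funM.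
- move=> x _; rewrite /= lee_fin [leRHS]ger0_norm ?exprn_ge0//.
  rewrite normrM ger0_norm; last by rewrite ln_ge0// jsq_ge1.
  apply: (@le_trans _ _ ((1 + enorm x ^+ 2) * profile x ^+ (2 * n))).
    apply: ler_pM => //; first by rewrite ln_ge0// jsq_ge1.
    by rewrite ltW// ln_sublinear// jsq_gt0.
  have n22 : (2 <= 2 * n)%N by rewrite mul2n -addnn (leq_trans (ltnW n2))//
    leq_addr.
  by rewrite -{1}(subnK n22) exprD mulrCA [_ * profile x ^+ 2]mulrC profile_jsq
    mulr1.
- rewrite ltn_subRL mul2n -addnn addnC.
  by rewrite ltn_add2l.
Qed.

Lemma first_integral_gt0 : (2 < n)%N ->
  0 < \int[mu_n]_x
    (ln (bubble x) * bubble x `^ critical_exponent R n * bubble_psi x).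
Proof.
move=> n2; have n0 : (0 < n)%N by exact: leq_trans n2.
have iD := integrable_D n2; have iL := integrable_lnD n2.
under eq_Rintegral do rewrite first_integrandE//.
rewrite RintegralZl//; apply: mulr_gt0.
  by rewrite exprn_gt0// divr_gt0// subr_gt0 ltr_nat.
have D0 : \int[mu_n]_x D x = 0.
  have iX k : (n < k)%N ->
    mu_n.-integrable setT (EFin \o (fun x => profile x ^+ k)).
    exact: integrable_profile.
  have n2n : (n < 2 * n)%N by rewrite mul2n -addnn -subn_gt0 addnK.
  have i2 : mu_n.-integrable setT
      (EFin \o (fun x => 2 * profile x ^+ (2 * n).+2)).
    apply: eq_integrable (integrableZl measurableT 2 (iX (2 * n).+2 _)) => //.
    by rewrite !leqW.
  rewrite RintegralB//; last exact: iX.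
  rewrite RintegralZl//; last by apply: iX; rewrite !leqW.
  by rewrite Rintegral_profile_double// subrr.
(* Both factors of [E] have the sign of [t - 2], and the subtracted multiple of [D] integrates to
   0. *)
pose E x : R := (ln (1 + enorm x ^+ 2) - ln 2) * D x.
have iE : mu_n.-integrable setT (EFin \o E).
  have := integrableB measurableT iL (integrableZl measurableT (ln 2) iD).
  by apply: eq_integrable => // x _ /=; rewrite -EFinB /E mulrBl.
have -> : \int[mu_n]_x (ln (1 + enorm x ^+ 2) * D x) = \int[mu_n]_x E x.
  rewrite -[LHS]subr0 -(mulr0 (ln 2)) -D0 -RintegralZl// -RintegralB//.
    by apply: eq_Rintegral => x _; rewrite /E mulrBl.
  exact: (integrableZl measurableT (ln 2) iD).
have E0 x : 0 <= E x.
  have t0 := jsq_gt0 x;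
    have w0 : 0 <= profile x ^+ (2 * n).+2 by rewrite exprn_ge0.
  rewrite /E DE; have [t2|/ltW t2] := leP 2 (1 + enorm x ^+ 2).
    apply: mulr_ge0; first by rewrite subr_ge0 ler_ln ?posrE.
    by rewrite mulr_ge0// subr_ge0.
  apply: mulr_le0; first by rewrite subr_le0 ler_ln ?posrE.
  by rewrite mulr_ge0_le0// subr_le0.
apply: fine_gt0; apply/andP; split; last first.
  by have := integrable_fin_num measurableT iE;
    rewrite fin_numE ltey => /andP[_].
(* On this cube a coordinate is at least 2, hence [t >= 5] and [E] is strictly positive. *)
apply: (integral_gt0_subset (A := cube 2 3)) => //.
- by have /integrableP[] := iE.
- exact: measurable_cube.
- by apply: lebesgue_rV_cube_gt0; rewrite ltr_nat.
move=> x xA; rewrite lte_fin /E DE.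
have t2 : 2 < 1 + enorm x ^+ 2.
  have := ler_coord_enorm x (Ordinal n0).
  have /andP[x2 _] := xA (Ordinal n0).
  rewrite ger0_norm; last by lra.
  by move=> xe; nra.
apply: mulr_gt0; first by rewrite subr_gt0 ltr_ln ?posrE ?jsq_gt0.
by apply: mulr_gt0; rewrite ?subr_gt0// exprn_gt0 ?profile_gt0.
Qed.

End first_integral_sign.

(** * Differences of powers *)

Section power_differences.
Context {R : realFieldType}.
Implicit Types p q : R.

Lemma exprn_dist_le p q (k : nat) : 0 <= p <= 1 -> 0 <= q <= 1 ->
  `|p ^+ k - q ^+ k| <= k%:R * `|p - q|.
Proof.
move=> /andP[p0 p1] /andP[q0 q1]; elim: k => [|k IHk].
  by rewrite !expr0 subrr normr0 mul0r.
have -> : p ^+ k.+1 - q ^+ k.+1 = p ^+ k * (p - q) + q * (p ^+ k - q ^+ k).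
  by rewrite !exprS; ring.
rewrite (le_trans (ler_normD _ _))// -natr1 mulrDl mul1r addrC lerD//.
  rewrite normrM ger0_norm// (le_trans _ IHk)// ler_piMl//.
by rewrite normrM ger0_norm ?exprn_ge0// ler_piMl// exprn_ile1.
Qed.

Lemma exprn_dist_le1 p q (k : nat) : 0 <= p <= 1 -> 0 <= q <= 1 ->
  `|p ^+ k - q ^+ k| <= 1.
Proof.
move=> /andP[p0 p1] /andP[q0 q1].
have := exprn_ile1 k p0 p1; have := exprn_ge0 k p0.
have := exprn_ile1 k q0 q1; have := exprn_ge0 k q0.
by move=> ? ? ? ?; rewrite ler_norml; apply/andP; split; lra.
Qed.

(** With [g] the gap at exponent [k + 1], the gap at [k + 3] is [q^2 g] plus
    [p (q + p) p^k (q - p)], the latter at most [2 q^2 g]. The total is at most [3 q^2 g], whence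
    the constant 6. *)
Lemma exprn_gap_le p q (k : nat) : 0 <= p -> p <= q -> 6 * q ^+ 2 <= 1 ->
  2 * (q ^+ k.+3 - p ^+ k.+3) <= q ^+ k.+1 - p ^+ k.+1.
Proof.
move=> p0 pq q6; have q0 : 0 <= q by exact: le_trans pq.
have pk := exprn_ge0 k p0.
have gap : p ^+ k * (q - p) <= q ^+ k.+1 - p ^+ k.+1.
  have : p ^+ k <= q ^+ k by rewrite lerXn2r.
  rewrite !exprS; nra.
set g := q ^+ k.+1 - p ^+ k.+1 in gap *.
have g0 : 0 <= g by rewrite subr_ge0 lerXn2r.
have -> : q ^+ k.+3 - p ^+ k.+3 = q ^+ 2 * g + p * (q + p) * (p ^+ k * (q - p)).
  by rewrite /g !exprS expr0; ring.
have : p * (q + p) <= 2 * q ^+ 2 by nra.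
have : 0 <= p * (q + p) by nra.
have : 0 <= p ^+ k * (q - p) by rewrite mulr_ge0// subr_ge0.
move: (p ^+ k * (q - p)) gap => w gap w0 h0 h1.
have : p * (q + p) * w <= 2 * q ^+ 2 * g by rewrite ler_pM.
nra.
Qed.

End power_differences.

(** * Sign and size of the numerator of the kernel *)

Section kernel_bounds.
Context {R : realType} {n : nat}.
Hypothesis n2 : (2 < n)%N.
Implicit Types (x y z : 'rV[R]_n) (s : R).

Let v01 x : 0 <= profile x <= 1.
Proof. by rewrite profile_le1 (ltW (profile_gt0 x)). Qed.

Let b_gt0 : 0 < (n%:R - 2) / 2 :> R.
Proof. by rewrite divr_gt0// subr_gt0 ltr_nat. Qed.

Let bubble_increment x y : R :=
  (bubble x - bubble y) * (bubble_psi x - bubble_psi y).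

(** If [profile x <= profile y], then [U] increases from [x] to [y], while [psi] decreases: by
    [exprn_gap_le] its term [- v ^ (n - 2)] outweighs [2 v ^ n]. *)
Lemma bubble_increment_le0 x y :
  6 * profile x ^+ 2 <= 1 -> 6 * profile y ^+ 2 <= 1 ->
    bubble_increment x y <= 0.
Proof.
rewrite /bubble_increment.
wlog xy : x y / profile x <= profile y => [wl x6 y6|x6 y6].
  have [/wl|/ltW /wl] := leP (profile x) (profile y); first exact.
  by move=> /(_ y6 x6);
    rewrite -(opprB (bubble x)) -(opprB (bubble_psi x)) mulrNN.
rewrite !bubble_psi_profile// !bubble_profile//.
have [k nE] : exists k, n = k.+3 by case: (n) n2 => [|[|[|k]]]// _; exists k.
have -> : (n - 2)%N = k.+1 by rewrite nE.
have nE3 : profile x ^+ n = profile x ^+ k.+3 by congr (_ ^+ _).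
have nE3' : profile y ^+ n = profile y ^+ k.+3 by congr (_ ^+ _).
rewrite nE3 nE3' {nE3 nE3'}.
have /andP[x0 _] := v01 x; have /andP[y0 _] := v01 y.
have gap := exprn_gap_le k x0 xy y6.
have : profile x ^+ k.+1 <= profile y ^+ k.+1 by rewrite lerXn2r.
rewrite -mulrBr mulrCA => le; rewrite mulr_ge0_le0 ?(ltW b_gt0)//.
nra.
Qed.

Lemma bubble_increment_bound : exists2 C : R, 0 <= C & forall x y,
  `|bubble_increment x y| <= C * Num.min 1 (enorm (x - y) ^+ 2).
Proof.
pose m : R := (n - 2)%:R; pose N : R := n%:R; pose b : R := (N - 2) / 2.
have b0 : 0 <= b by exact: ltW.
have m0 : 0 <= m by exact: ler0n.
have N0 : 0 <= N by exact: ler0n.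
(* The term 3 comes from bounding differences of powers of [profile] by 1, the other from bounding
   them by multiples of [d], as [profile] is Lipschitz. *)
exists (b * (m * (2 * N + m) + 3)).
  by rewrite mulr_ge0// addr_ge0// mulr_ge0// addr_ge0// mulr_ge0.
move=> x y; set d := enorm (x - y).
have d0 : 0 <= d := enorm_ge0 _.
have vd := profile_lipschitz x y; rewrite -/d in vd.
rewrite /bubble_increment !bubble_psi_profile// !bubble_profile// -/b.
have dU := exprn_dist_le (n - 2) (v01 x) (v01 y).
have dU1 := exprn_dist_le1 (n - 2) (v01 x) (v01 y).
have dV := exprn_dist_le n (v01 x) (v01 y).
have dV1 := exprn_dist_le1 n (v01 x) (v01 y).
move: dU dU1 dV dV1; rewrite -/m -/N.
move: (profile x ^+ _) (profile y ^+ _) (profile x ^+ _) (profile y ^+ _).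
move=> C D A B dU dU1 dV dV1.
have dUd : `|A - B| <= m * d by rewrite (le_trans dU)// ler_wpM2l.
have dVd : `|C - D| <= N * d by rewrite (le_trans dV)// ler_wpM2l.
have -> : (A - B) * (b * (2 * C - A) - b * (2 * D - B)) =
  b * ((A - B) * (2 * (C - D) - (A - B))) by ring.
rewrite normrM (ger0_norm b0) -mulrA ler_wpM2l// normrM.
have nd : `|2 * (C - D) - (A - B)| <= 2 * `|C - D| + `|A - B|.
  by rewrite (le_trans (ler_normB _ _))// normrM (ger0_norm (ler0n R 2)).
have U0 := normr_ge0 (A - B); have V0 := normr_ge0 (C - D).
rewrite /Num.min; case: ifP => _.
- have : `|A - B| * `|2 * (C - D) - (A - B)| <= 1 * 3 by apply: ler_pM => //;
  lra.
  have : 0 <= m * (2 * N + m) by rewrite mulr_ge0// addr_ge0// mulr_ge0.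
  lra.
- have : `|A - B| * `|2 * (C - D) - (A - B)| <= (m * d) * ((2 * N + m) * d).
    by apply: ler_pM => //; lra.
  have : 0 <= d ^+ 2 by exact: sqr_ge0.
  lra.
Qed.

End kernel_bounds.

(** * Integrals of a function of [x - y] with one point in a ball *)

Section difference_weight.
Context {R : realType} {n : nat}.
Local Notation mu_n := (lebesgue_rV R n).
Local Notation lebesgue_pair := (@lebesgue_pair R n).
Implicit Types (x y z : 'rV[R]_n).

Lemma measurable_sub_rV : measurable_fun setT
  (fun w : 'rV[R]_n * 'rV[R]_n => w.1 - w.2).
Proof.
apply: measurable_fun_rVP => i; under eq_fun do rewrite !mxE.
apply: measurable_funB.
  exact: (measurableT_comp (measurable_coord i) measurable_fst).
exact: (measurableT_comp (measurable_coord i) measurable_snd).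
Qed.

Local Open Scope ereal_scope.

(** In each term the variable outside the indicator is integrated first, which gives the integral of
    [W]; the ball then contributes its volume. *)
Lemma integral_ball_difference_lty (r : R) (W : 'rV[R]_n -> \bar R) :
  measurable_fun setT W -> (forall z, 0 <= W z) -> \int[mu_n]_z W z < +oo ->
  \int[lebesgue_pair]_w (((\1_[set z | (enorm z <= r)%R] w.1)%:E +
    (\1_[set z | (enorm z <= r)%R] w.2)%:E) * W (w.1 - w.2)%R) < +oo.
Proof.
move=> mW W0 Woo.
set B := [set z | (enorm z <= r)%R].
have mB : measurable B by exact: measurable_enorm_ball.
have I0 z : 0 <= (\1_B z)%:E :> \bar R by rewrite lee_fin indicE ler0n.
have mI : measurable_fun setT (fun z => (\1_B z)%:E : \bar R).
  by apply/measurable_EFinP; exact: measurable_indic.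
have mWs : measurable_fun setT (fun w : 'rV[R]_n * 'rV[R]_n => W (w.1 - w.2)%R).
  exact: (measurableT_comp mW measurable_sub_rV).
have m1 : measurable_fun setT
    (fun w : 'rV[R]_n * 'rV[R]_n => (\1_B w.1)%:E * W (w.1 - w.2)%R).
  by apply: emeasurable_funM => //; exact: (measurableT_comp mI measurable_fst).
have m2 : measurable_fun setT
    (fun w : 'rV[R]_n * 'rV[R]_n => (\1_B w.2)%:E * W (w.1 - w.2)%R).
  by apply: emeasurable_funM => //; exact: (measurableT_comp mI measurable_snd).
have mp1 x : measurable_fun setT (fun y : 'rV[R]_n => (x, y)).
  by apply: measurable_fun_pair.
have mp2 y : measurable_fun setT (fun x : 'rV[R]_n => (x, y)).
  by apply: measurable_fun_pair.
have intB : \int[mu_n]_z (\1_B z)%:E < +oo.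
  by rewrite integral_indic ?setIT//; exact: lebesgue_rV_ball_lty.
have prod_lty : (\int[mu_n]_z (\1_B z)%:E) * \int[mu_n]_z W z < +oo.
  by rewrite lte_mul_pinfty ?integral_ge0// ge0_fin_numE ?integral_ge0.
under eq_integral do rewrite ge0_muleDl//.
rewrite ge0_integralD//; last 2 first.
- by move=> w _; rewrite mule_ge0.
- by move=> w _; rewrite mule_ge0.
rewrite lte_add_pinfty//.
  rewrite integral_lebesgue_pair//; last by move=> w; rewrite mule_ge0.
  have intE x : \int[mu_n]_y ((\1_B x)%:E * W (x - y)%R) =
      (\1_B x)%:E * \int[mu_n]_z W z.
    rewrite ge0_integralZl//; last first.
      exact: (measurableT_comp mWs (mp1 x)).
    under eq_integral do rewrite -scaleN1r addrC.
    rewrite (integral_affine_rV x (a := -1)%R) ?oppr_eq0 ?oner_eq0//.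
    by rewrite normrN1 expr1n invr1 mul1e.
  under eq_integral do rewrite /= intE.
  by rewrite ge0_integralZr// integral_ge0.
rewrite (fubini_tonelli2 (fun w : 'rV[R]_n * 'rV[R]_n =>
  (\1_B w.2)%:E * W (w.1 - w.2)%R))//; last by move=> w; rewrite mule_ge0.
rewrite /fubini_G/=.
have intE y : \int[mu_n]_x ((\1_B y)%:E * W (x - y)%R) =
    (\1_B y)%:E * \int[mu_n]_z W z.
  rewrite ge0_integralZl//; last first.
    exact: (measurableT_comp mWs (mp2 y)).
  under eq_integral => x _ do rewrite -[x in W (x - y)%R]scale1r.
  rewrite (integral_affine_rV (- y)%R (a := 1)%R)// normr1 expr1n invr1 mul1e.
  by [].
under eq_integral do rewrite intE.
by rewrite ge0_integralZr// integral_ge0.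
Qed.

End difference_weight.

(** * Finiteness of the positive part of the kernel *)

Section bubble_kernel.
Context {R : realType} {n : nat} (s : R).
Hypotheses (n2 : (2 < n)%N) (s_gt0 : 0 < s) (s_lt1 : s < 1).
Local Notation mu_n := (lebesgue_rV R n).
Local Notation lebesgue_pair := (@lebesgue_pair R n).
Local Notation U := (@bubble R n).
Local Notation psi := (@bubble_psi R n).
Implicit Types (x y z : 'rV[R]_n) (w : 'rV[R]_n * 'rV[R]_n).

Let al : R := n%:R + 2 * s.

Let n3 : 3 <= n%:R :> R. Proof. by rewrite ler_nat. Qed.

Let al_core : 1 <= al - 2 < n%:R.
Proof.
by have := n3; have := s_gt0; have := s_lt1; rewrite /al => *; apply/andP;
  split; lra.
Qed.

Let al_tail : n%:R < al.
Proof. by have := s_gt0; rewrite /al => ?; lra. Qed.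

Definition bubble_kernel w : R := gagliardo_kernel s U psi w.1 w.2.

Lemma measurable_bubble : measurable_fun setT U.
Proof.
rewrite (_ : U = fun x => profile x ^+ (n - 2)).
  by apply: measurable_funX; exact: measurable_profile.
by apply/funext => x; exact: bubble_profile.
Qed.

Lemma measurable_bubble_psi : measurable_fun setT psi.
Proof.
rewrite (_ : psi = fun x => (n%:R - 2) / 2 *
    (2 * profile x ^+ n - profile x ^+ (n - 2))).
  apply: measurable_funM => //; apply: measurable_funB.
    by apply: measurable_funM => //; apply: measurable_funX;
      exact: measurable_profile.
  by apply: measurable_funX; exact: measurable_profile.
by apply/funext => x; exact: bubble_psi_profile.
Qed.

Let measurable_fst_snd (f : 'rV[R]_n -> R) : measurable_fun setT f ->
  measurable_fun setT (fun w => f w.1 - f w.2).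
Proof.
move=> mf; apply: measurable_funB;
  first exact: (measurableT_comp mf measurable_fst).
exact: (measurableT_comp mf measurable_snd).
Qed.

Let measurable_dist : measurable_fun setT (fun w => (enorm (w.1 - w.2) `^
  al)^-1).
Proof.
under eq_fun do rewrite -powRN.
apply: (measurableT_comp (measurable_powR _)).
exact: (measurableT_comp measurable_enorm measurable_sub_rV).
Qed.

Lemma measurable_bubble_kernel : measurable_fun setT bubble_kernel.
Proof.
apply: measurable_funM; last exact: measurable_dist.
apply: measurable_funM.
  exact: (measurable_fst_snd measurable_bubble).
exact: (measurable_fst_snd measurable_bubble_psi).
Qed.

(** A bound for [min(1, |z|^2) / |z| ^ al], split into a core and a tail that are integrable
    separately. *)
Let weight z : R := (if enorm z <= 1 then enorm z `^ (- (al - 2)) else 0) +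
  (if 1 < enorm z then enorm z `^ (- al) else 0).

Let weight_ge0 z : 0 <= weight z.
Proof. by rewrite /weight; apply: addr_ge0; case: ifP => // _;
  rewrite powR_ge0. Qed.

Let measurable_core : measurable_fun setT
  (fun z => if enorm z <= 1 then enorm z `^ (- (al - 2)) else 0).
Proof.
apply: measurable_fun_ifT => //.
  by apply: measurable_fun_ler => //; exact: measurable_enorm.
exact: (measurableT_comp (measurable_powR _) measurable_enorm).
Qed.

Let measurable_tail : measurable_fun setT
  (fun z => if 1 < enorm z then enorm z `^ (- al) else 0).
Proof.
apply: measurable_fun_ifT => //.
  by apply: measurable_fun_ltr => //; exact: measurable_enorm.
exact: (measurableT_comp (measurable_powR _) measurable_enorm).
Qed.

Let measurable_weight : measurable_fun setT (EFin \o weight).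
Proof. by apply/measurable_EFinP; exact: measurable_funD. Qed.

Let integral_weight_lty : (\int[mu_n]_z (weight z)%:E < +oo)%E.
Proof.
rewrite /weight; under eq_integral do rewrite EFinD.
rewrite ge0_integralD//; last 4 first.
- by move=> z _; rewrite lee_fin; case: ifP => // _; exact: powR_ge0.
- exact/measurable_EFinP.
- by move=> z _; rewrite lee_fin; case: ifP => // _; exact: powR_ge0.
- exact/measurable_EFinP.
rewrite lte_add_pinfty//.
  by have /andP[? ?] := al_core; exact: integral_enorm_core.
exact: integral_enorm_tail.
Qed.

Let min_weight z : Num.min 1 (enorm z ^+ 2) / enorm z `^ al <= weight z.
Proof.
have d0 := enorm_ge0 z; rewrite /weight -powRN.
have min0 : 0 <= Num.min 1 (enorm z ^+ 2) by rewrite le_min ler01 sqr_ge0.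
have [d1|d1] := leP (enorm z) 1; last first.
  by rewrite add0r ler_piMl ?powR_ge0// ge_min lexx.
rewrite addr0; have [->|dn0] := eqVneq (enorm z) 0.
  have /andP[al1 _] := al_core.
  by rewrite !powR0 ?mulr0// oppr_eq0 gt_eqF//; lra.
have -> : - (al - 2) = 2%:R - al by ring.
rewrite powRD ?dn0 ?implybT// powR_mulrn// ler_wpM2r ?powR_ge0//.
by rewrite ge_min lexx orbT.
Qed.

Let B := [set z : 'rV[R]_n | enorm z <= 3].

(** By [bubble_increment_le0] a positive kernel forces [x] or [y] into [B], so the positive part is
    at most [C] times the sum of the two indicators times [weight (x - y)]. *)
Lemma bubble_kernel_pos_lty :
  (\int[lebesgue_pair]_w (Num.max (bubble_kernel w) 0)%:E < +oo)%E.
Proof.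
have [C C0 bound] := @bubble_increment_bound R n n2.
have mB : measurable B by exact: measurable_enorm_ball.
have mI : measurable_fun setT (fun z => (\1_B z)%:E : \bar R).
  by apply/measurable_EFinP; exact: measurable_indic.
have mh : measurable_fun setT (fun w : 'rV[R]_n * 'rV[R]_n =>
    (((\1_B w.1)%:E + (\1_B w.2)%:E) * (weight (w.1 - w.2))%:E)%E).
  apply: emeasurable_funM.
    apply: emeasurable_funD; first exact: (measurableT_comp mI measurable_fst).
    exact: (measurableT_comp mI measurable_snd).
  exact: (measurableT_comp measurable_weight measurable_sub_rV).
have h0 (w : 'rV[R]_n * 'rV[R]_n) :
    (0 <= ((\1_B w.1)%:E + (\1_B w.2)%:E) * (weight (w.1 - w.2))%:E)%E.
  by rewrite mule_ge0 ?lee_fin// adde_ge0// lee_fin indicE ler0n.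
apply: (@le_lt_trans _ _ (\int[lebesgue_pair]_w (C%:E *
  (((\1_B w.1)%:E + (\1_B w.2)%:E) * (weight (w.1 - w.2))%:E)))%E); last first.
  rewrite ge0_integralZl// lte_mul_pinfty//.
  exact: (integral_ball_difference_lty 3 measurable_weight).
apply: ge0_le_integral => //.
- by move=> w _; rewrite lee_fin le_max lexx orbT.
- by apply/measurable_EFinP; apply: measurable_maxr => //;
  exact: measurable_bubble_kernel.
- by apply: emeasurable_funM => //; exact: measurable_cst.
move=> [x y] _ /=; rewrite -EFinD -!EFinM lee_fin ge_max.
have rhs0 : 0 <= C * ((\1_B x + \1_B y) * weight (x - y)).
  by apply: mulr_ge0 => //; apply: mulr_ge0 => //;
    rewrite addr_ge0 ?indicE ?ler0n.
apply/andP; split => //.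
rewrite /bubble_kernel/=.
have dV0 : 0 <= (enorm (x - y) `^ al)^-1 by rewrite invr_ge0 powR_ge0.
have [K0|K0] := leP (gagliardo_kernel s U psi x y) 0.
  by rewrite (le_trans K0).
have N0 : 0 < (U x - U y) * (psi x - psi y).
  rewrite ltNge; apply/negP => N0; move: K0; rewrite ltNge => /negP; apply.
  by rewrite mulr_le0_ge0.
(* The hypothesis means [1 + |z|^2 < 6], so the radius 3 of [B] is ample. *)
have nearB z : 1 < 6 * profile z ^+ 2 -> \1_B z = 1 :> R.
  move=> v6; suff zB : enorm z <= 3 by rewrite indicE mem_set.
  have := jsq_gt0 z; have := profile_jsq z; have := enorm_ge0 z.
  by move: (profile z ^+ 2) v6 => v v6 e0 vt t0; nra.
have ind1 : 1 <= \1_B x + \1_B y :> R.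
  have [x6|/nearB ->] := leP (6 * profile x ^+ 2) 1; last first.
    by rewrite lerDl indicE ler0n.
  have [y6|/nearB ->] := leP (6 * profile y ^+ 2) 1; last first.
    by rewrite lerDr indicE ler0n.
  by move: N0; rewrite ltNge (bubble_increment_le0 n2 x6 y6).
apply: (@le_trans _ _ (C * weight (x - y))); last first.
  by rewrite ler_wpM2l// ler_peMl.
apply: (@le_trans _ _ (C * Num.min 1 (enorm (x - y) ^+ 2) / enorm (x - y) `^
  al)).
  by rewrite ler_wpM2r// (le_trans (ler_norm _))// bound.
by rewrite -mulrA ler_wpM2l// min_weight.
Qed.

End bubble_kernel.

(** * The scaled energy along orbits *)

Section bubble_balance.
Context {R : realType} {n : nat} (s : R).
Hypotheses (n2 : (2 < n)%N) (s_gt0 : 0 < s) (s_lt1 : s < 1).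
Local Notation lebesgue_pair := (@lebesgue_pair R n).
Local Notation U := (@bubble R n).
Local Notation psi := (@bubble_psi R n).
Implicit Types (x y z : 'rV[R]_n) (w : 'rV[R]_n * 'rV[R]_n).

Let al : R := n%:R + 2 * s.

(* The factor [u ^+ (n - 2)] makes [u |-> u ^ ((n - 2) / 2) * U (u x)] appear,
   whose derivative is [u ^ ((n - 4) / 2) * psi (u x)]. *)
Definition scaled_energy w (u : R) : R :=
  2^-1 * (u ^+ (n - 2) * (U (u *: w.1) - U (u *: w.2)) ^+ 2 *
    (enorm (w.1 - w.2) `^ al)^-1).

Let is_derive_exprn (u : R) (k : nat) :
  is_derive u 1 (fun t : R => t ^+ k) (k%:R * u ^+ k.-1).
Proof.
rewrite (_ : (fun t : R => t ^+ k) = (@id R) ^+ k).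
  by apply: (is_derive_eq (is_deriveX k (is_derive_id u 1)));
    rewrite /GRing.scale/= mulr1.
by apply/funext => t; elim: k => [|k IHk]; rewrite ?expr0// !exprS IHk.
Qed.

Lemma kernel_dilateE w (u : R) : bubble_kernel s (dilate_pair u w) =
  (U (u *: w.1) - U (u *: w.2)) * (psi (u *: w.1) - psi (u *: w.2)) *
  (`|u| `^ (- al) * (enorm (w.1 - w.2) `^ al)^-1).
Proof.
rewrite /bubble_kernel /gagliardo_kernel/= -scalerBr enormZ.
by rewrite powRM ?enorm_ge0// invfM powRN.
Qed.

(** The derivative is [u ^ (n - 3)] times the increments of [U] and [psi] over [|x - y| ^ al]; the
    kernel at the dilated pair carries [u ^ (- al)], which the factor [u ^ al] undoes. *)
Lemma is_derive_scaled_energy w (u : R) : 0 < u ->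
  is_derive u 1 (scaled_energy w)
    (u `^ (n%:R - 3 + al) * bubble_kernel s (dilate_pair u w)).
Proof.
move=> u0; rewrite kernel_dilateE gtr0_norm//.
set c := (enorm _ `^ al)^-1.
have [k nE] : exists k, (n - 3 = k)%N by exists (n - 3)%N.
have n2E : (n - 2 = k.+1)%N by rewrite -nE -subSn.
have nE' : n%:R = k%:R + 3 :> R by rewrite -nE natrB// subrK.
have dx := is_derive_profileX w.1 (n - 2) u0.
have dy := is_derive_profileX w.2 (n - 2) u0.
have dU := is_deriveB dx dy.
have dE := is_deriveM (is_derive_exprn u (n - 2)) (is_deriveM dU dU).
have dZ := is_deriveZ (2^-1 * c) dE.
have -> : scaled_energy w = (2^-1 * c) \*: ((fun t : R => t ^+ (n - 2)) *
    (((fun t : R => profile (t *: w.1) ^+ (n - 2)) -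
      (fun t : R => profile (t *: w.2) ^+ (n - 2))) *
     ((fun t : R => profile (t *: w.1) ^+ (n - 2)) -
      (fun t : R => profile (t *: w.2) ^+ (n - 2))))).
  apply/funext => t; rewrite /scaled_energy !bubble_profile// -/c.
  transitivity (2^-1 * c * (t ^+ (n - 2) *
    ((profile (t *: w.1) ^+ (n - 2) - profile (t *: w.2) ^+ (n - 2)) *
     (profile (t *: w.1) ^+ (n - 2) - profile (t *: w.2) ^+ (n - 2))))) => //.
  by ring.
apply: (is_derive_eq dZ).
rewrite !bubble_profile// !bubble_psi_profile//.
have -> : (n - 2).+2 = n by rewrite -addn2 subnK// ltnW.
have -> : u `^ (n%:R - 3 + al) = u ^+ k * u `^ al.
  rewrite powRD; last by apply/implyP => _; rewrite gt_eqF.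
  by congr (_ * _); rewrite nE' addrK powR_mulrn// ltW.
have ua : u `^ al != 0 by rewrite gt_eqF// powR_gt0.
have subE (f g : R -> R) t : (f - g) t = f t - g t by [].
have mulE (f g : R -> R) t : (f * g) t = f t * g t by [].
have kE : k.+1%:R = k%:R + 1 :> R by rewrite natr1.
rewrite (powRN u al) mulE !subE /GRing.scale/= n2E/= nE' exprS kE.
move: (profile (u *: w.1) ^+ _) (profile (u *: w.2) ^+ _).
move: (profile (u *: w.1) ^+ _) (profile (u *: w.2) ^+ _) => p q P Q.
by field; rewrite ua gt_eqF.
Qed.

Lemma continuous_kernel_dilate w (u : R) : 0 < u ->
  {for u, continuous (fun t => bubble_kernel s (dilate_pair t w))}.
Proof.
move=> u0.
have -> : (fun t => bubble_kernel s (dilate_pair t w)) = (fun t =>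
  (profile (t *: w.1) ^+ (n - 2) - profile (t *: w.2) ^+ (n - 2)) *
  ((n%:R - 2) / 2 * (2 * profile (t *: w.1) ^+ n - profile (t *: w.1) ^+ (n -
    2)) -
   (n%:R - 2) / 2 * (2 * profile (t *: w.2) ^+ n - profile (t *: w.2) ^+ (n -
     2))) *
  (`|t| `^ (- al) * (enorm (w.1 - w.2) `^ al)^-1)).
  by apply/funext => t;
    rewrite kernel_dilateE !bubble_profile// !bubble_psi_profile.
have cX z k := continuous_profileX (x := z) (k := k) u0.
apply: continuousM.
  apply: continuousM; first by apply: continuousB; exact: cX.
  apply: continuousB; apply: continuousM;
    [exact: cst_continuous| |exact: cst_continuous| ];
  apply: continuousB; try exact: cX;
  apply: continuousM; [exact: cst_continuous|exact: cX|exact: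
    cst_continuous|exact: cX].
apply: continuousM; last exact: cst_continuous.
apply: (@continuous_comp _ _ _ (fun t : R => `|t|) (fun t => t `^ (- al))).
  exact: norm_continuous.
apply/differentiable_continuous/derivable1_diffP.
by apply: derivable_powR; rewrite in_itv/= andbT normr_gt0 gt_eqF.
Qed.

(** Since [(p - q)^2 <= p^2 + q^2] for nonnegative [p] and [q], the energy is controlled by
    [(u v ^ 2) ^ (n - 2)] at the two points, which tends to 0 by [cvg_profile]. *)
Lemma cvg_scaled_energy w : w.1 != 0 -> w.2 != 0 ->
  scaled_energy w u @[u --> +oo] --> (0 : R).
Proof.
move=> x0 y0; set c := (enorm (w.1 - w.2) `^ al)^-1.
have c0 : 0 <= c by rewrite invr_ge0 powR_ge0.
have n20 : (0 < n - 2)%N by rewrite subn_gt0.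
apply: (@squeeze_cvgr _ _ _ _ (fun=> 0) (fun u : R => 2^-1 *
  (((u * profile (u *: w.1) ^+ 2) ^+ (n - 2) +
    (u * profile (u *: w.2) ^+ 2) ^+ (n - 2)) * c))); last 2 first.
- exact: cvg_cst.
- have cv z : z != 0 ->
  (u * profile (u *: z) ^+ 2) ^+ (n - 2) @[u --> +oo] --> (0 : R).
    move=> z0; have := @exprn_continuous R (n - 2) 0.
    rewrite /continuous_at expr0n gtn_eqF// => e0.
    by apply: cvg_comp e0; exact: cvg_profile.
  rewrite -(mulr0 2^-1) -[X in _ * X](mul0r c) -[X in X * c]addr0.
  apply: cvgM; first exact: cvg_cst.
  by apply: cvgM; [apply: cvgD; exact: cv|exact: cvg_cst].
near=> u.
have u0 : 0 < u by near: u; apply: nbhs_pinfty_gt; exact: num_real.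
have um : 0 <= u ^+ (n - 2) by rewrite exprn_ge0// ltW.
rewrite /scaled_energy -/c; apply/andP; split.
  by apply: mulr_ge0 => //; rewrite mulr_ge0// mulr_ge0// sqr_ge0.
have uE z : (u * profile (u *: z) ^+ 2) ^+ (n - 2) =
    u ^+ (n - 2) * (profile (u *: z) ^+ (n - 2)) ^+ 2.
  by rewrite exprMn -!exprM mulnC.
rewrite !uE -mulrDr !bubble_profile//.
rewrite ler_wpM2l// ler_wpM2r// ler_wpM2l//.
set p := _ ^+ (n - 2); set q := _ ^+ (n - 2).
have p0 : 0 <= p by rewrite exprn_ge0// ltW ?profile_gt0.
have q0 : 0 <= q by rewrite exprn_ge0// ltW ?profile_gt0.
nra.
Unshelve. all: by end_near. Qed.

End bubble_balance.

(** * The negative part outweighs the positive part *)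

Section strict_inequality.
Context {R : realType} {n : nat} (s : R).
Hypotheses (n2 : (2 < n)%N) (s_gt0 : 0 < s) (s_lt1 : s < 1).
Local Notation lebesgue_pair := (@lebesgue_pair R n).
Local Notation U := (@bubble R n).
Implicit Types (x y z : 'rV[R]_n) (w : 'rV[R]_n * 'rV[R]_n).

Let al : R := n%:R + 2 * s.

Let energy_ge0 w : 0 <= scaled_energy s w 1.
Proof.
rewrite /scaled_energy mulr_ge0// mulr_ge0//; last by rewrite invr_ge0 powR_ge0.
by apply: mulr_ge0; [exact: exprn_ge0|exact: sqr_ge0].
Qed.

Let measurable_energy : measurable_fun setT (fun w => scaled_energy s w 1).
Proof.
apply: measurable_funM => //; apply: measurable_funM; last first.
  under eq_fun do rewrite -powRN.
  apply: (measurableT_comp (measurable_powR _)).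
  exact: (measurableT_comp measurable_enorm measurable_sub_rV).
apply: measurable_funM => //.
under eq_fun do rewrite !scale1r.
apply: measurable_funX; apply: measurable_funB.
  exact: (measurableT_comp (measurable_bubble n2) measurable_fst).
exact: (measurableT_comp (measurable_bubble n2) measurable_snd).
Qed.

(** Points of the two cubes lie at different distances from the origin, where the radially
    decreasing [U] takes different values. *)
Let integral_energy_gt0 : (0 < \int[lebesgue_pair]_w (scaled_energy s w
  1)%:E)%E.
Proof.
apply: (integral_gt0_subset (A := cube 1 2 `*` cube 3 4)).
- exact/measurable_EFinP.
- by move=> w; rewrite lee_fin.
- by apply: measurableX; exact: measurable_cube.
- rewrite /= product_measure1E; try exact: measurable_cube.
  by apply: mule_gt0; apply: lebesgue_rV_cube_gt0; lra.
move=> [x y] [/= xA yA]; rewrite lte_fin /scaled_energy/= !scale1r.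
have n0 : (0 < n)%N by exact: leq_trans n2.
have xy : enorm x ^+ 2 < enorm y ^+ 2.
  rewrite !sqr_enorm; apply: ltr_sum => [|i _].
    by apply/hasP; exists (Ordinal n0); rewrite ?mem_index_enum.
  by have /andP[? ?] := xA i; have /andP[? ?] := yA i; nra.
have vxy : profile y < profile x.
  rewrite ltf_pV2 ?posrE ?sqrtr_gt0 ?jsq_gt0//.
  by rewrite ltr_sqrt ?jsq_gt0// ltrD2l.
have Uxy : U y < U x.
  by rewrite !bubble_profile// ltrXn2r ?(ltW (profile_gt0 _))// -lt0n subn_gt0.
have dxy : 0 < enorm (x - y).
  rewrite lt_neqAle enorm_ge0 andbT eq_sym; apply/eqP => /enorm_eq0/eqP.
  by rewrite subr_eq0 => /eqP exy; move: xy; rewrite exy ltxx.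
by rewrite expr1n mul1r mulr_gt0 ?divr_gt0 ?powR_gt0 ?exprn_gt0 ?subr_gt0.
Qed.

(** Here [e + k + 1 = (n - 3 + al) - 2 n + 1 = 2 s - 2], negative as [s < 1]. *)
Lemma bubble_kernel_balance :
  ((2 - 2 * s)^-1%:E * \int[lebesgue_pair]_w (Num.max (- bubble_kernel s w)
    0)%:E =
   \int[lebesgue_pair]_w (scaled_energy s w 1)%:E +
   (2 - 2 * s)^-1%:E * \int[lebesgue_pair]_w (Num.max (bubble_kernel s w)
     0)%:E)%E.
Proof.
have n0 : (0 < n)%N by exact: leq_trans n2.
have eE : - (n%:R - 3 + al + - (2 * n%:R) + 1) = 2 - 2 * s by rewrite /al; ring.
have h1 := s_lt1.
rewrite -eE; apply: (@dilation_balance R _ _ lebesgue_pair dilate_pair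
  (- (2 * n%:R)) measurable_dilate_pair integral_dilate_pair
  (n%:R - 3 + al) (bubble_kernel s) (scaled_energy s)) => //.
- by rewrite /al; lra.
- exact: measurable_bubble_kernel.
apply: filterS (ae_pair_neq0 n0) => w [x0 y0]; split.
- by move=> u u1; apply: is_derive_scaled_energy => //; lra.
- by move=> u u1; apply: continuous_kernel_dilate => //; lra.
- exact: cvg_scaled_energy.
Qed.

Lemma bubble_kernel_pos_lt_neg :
  (\int[lebesgue_pair]_w (Num.max (bubble_kernel s w) 0)%:E <
   \int[lebesgue_pair]_w (Num.max (- bubble_kernel s w) 0)%:E)%E.
Proof.
have := bubble_kernel_pos_lty n2 s_gt0 s_lt1.
have := bubble_kernel_balance; have := integral_energy_gt0.
have c0 : 0 < (2 - 2 * s)^-1 by have := s_lt1; rewrite invr_gt0; lra.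
have pos_ge0 : (0 <= \int[lebesgue_pair]_w (Num.max (bubble_kernel s w)
  0)%:E)%E.
  by apply: integral_ge0 => w _; rewrite lee_fin le_max lexx orbT.
have neg_ge0 : (0 <= \int[lebesgue_pair]_w (Num.max (- bubble_kernel s w)
  0)%:E)%E.
  by apply: integral_ge0 => w _; rewrite lee_fin le_max lexx orbT.
move: (_^-1) c0 => c c0 E0 balE posoo.
rewrite -(@lte_pmul2l _ c%:E) ?lte_fin//.
(* The energy is allowed to be infinite; adding it is strict because the positive part is finite. *)
rewrite balE lteDr//.
by rewrite fin_numM// ge0_fin_numE.
Qed.

End strict_inequality.

(** * From the two parts to the signed iterated integral *)

Section iterated_integral.
Context {R : realType} {d1 d2} {T1 : measurableType d1} {T2 : measurableType
  d2}.
Variables (m1 : {sigma_finite_measure set T1 -> \bar R})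
  (m2 : {sigma_finite_measure set T2 -> \bar R}).
Local Open Scope ereal_scope.

(** The inner integral is [f = hp - hn]. The relation [f^\+ + hn = f^\- + hp] transfers the
    comparison of [hp] with [hn] to the parts of [f], even when the negative integrals are
    infinite. *)
Lemma iterated_integral_lt0 (K : T1 * T2 -> R) :
  measurable_fun setT K ->
  \int[m1]_x \int[m2]_y (Num.max (K (x, y)) 0)%:E < +oo ->
  \int[m1]_x \int[m2]_y (Num.max (K (x, y)) 0)%:E <
    \int[m1]_x \int[m2]_y (Num.max (- K (x, y)) 0)%:E ->
  \int[m1]_x \int[m2]_y (K (x, y))%:E < 0.
Proof.
move=> mK; set hp := fun x => \int[m2]_y (Num.max (K (x, y)) 0)%:E.
set hn := fun x => \int[m2]_y (Num.max (- K (x, y)) 0)%:E.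
pose f x := \int[m2]_y (K (x, y))%:E.
have mmax (g : T1 * T2 -> R) : measurable_fun setT g ->
    measurable_fun setT (fun x => \int[m2]_y (Num.max (g (x, y)) 0)%:E).
  move=> mg.
  apply: (measurable_fun_fubini_tonelli_F (m2 := m2) (fun z => (Num.max (g z)
    0)%:E)).
    by apply/measurable_EFinP; apply: measurable_maxr.
  by move=> z; rewrite lee_fin le_max lexx orbT.
have mhp : measurable_fun setT hp by exact: mmax.
have mhn : measurable_fun setT hn.
  by apply: (mmax (fun z => - K z)%R); exact: measurable_funN.
have hp0 x : 0 <= hp x.
  by apply: integral_ge0 => y _; rewrite lee_fin le_max lexx orbT.
have hn0 x : 0 <= hn x.
  by apply: integral_ge0 => y _; rewrite lee_fin le_max lexx orbT.
have fE : f = (fun x => hp x - hn x).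
  apply/funext => x; rewrite /f integralE; congr (_ - _);
    apply: eq_integral => y _.
    by rewrite funeposE EFin_max.
  by rewrite funenegE -EFinN EFin_max.
have mf : measurable_fun setT f by rewrite fE; exact: emeasurable_funB.
(* With [+oo - +oo = -oo] this holds without any finiteness assumption. *)
have parts x : f^\+ x + hn x = f^\- x + hp x.
  rewrite fE funeposE funenegE; have := hp0 x; have := hn0 x.
  case: (hp x) (hn x) => [a| |] [b| |]//= b0 a0.
  - rewrite -?EFinB -?EFinN -!EFin_max -!EFinD; congr EFin.
    have [ab|ba] := leP a b.
      by rewrite max_r ?subr_le0// max_l ?oppr_ge0 ?subr_le0//; lra.
    by rewrite max_l ?subr_ge0 ?(ltW ba)// max_r ?oppr_le0 ?subr_ge0 ?(ltW
      ba)//; lra.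
  - by rewrite addeNy maxNye maxye add0e addye.
  - by rewrite addye// maxNye add0e.
  - by rewrite addeNy maxNye maxye add0e addye.
have fp_le x : f^\+ x <= hp x.
  rewrite fE funeposE ge_max hp0 andbT.
  have := hp0 x; have := hn0 x.
  case: (hp x) (hn x) => [a| |] [b| |]//=;
    rewrite ?leey ?leNye// !lee_fin => b0 a0.
  by rewrite lerBlDr lerDl.
move=> Ip_oo Ip_lt.
have Ifp_oo : \int[m1]_x f^\+ x < +oo.
  apply: le_lt_trans Ip_oo; apply: ge0_le_integral => //.
  exact: measurable_funepos.
have : \int[m1]_x f^\+ x + \int[m1]_x hn x =
  \int[m1]_x f^\- x + \int[m1]_x hp x.
  rewrite -!ge0_integralD//; try exact: measurable_funepos;
    try exact: measurable_funeneg.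
  by apply: eq_integral => x _; exact: parts.
rewrite -/f [X in _ -> X < _]integralE.
have : 0 <= \int[m1]_x f^\+ x by exact: integral_ge0.
have : 0 <= \int[m1]_x f^\- x by exact: integral_ge0.
have : 0 <= \int[m1]_x hp x by exact: integral_ge0.
move: Ifp_oo Ip_oo Ip_lt; rewrite -/hp -/hn.
move: (\int[m1]_x hp x) (\int[m1]_x hn x) (\int[m1]_x f^\+ x) (\int[m1]_x f^\-
  x).
(* The integrals of [hp] and [f^\+] are finite, so those of [hn] and [f^\-] are finite or infinite
   together; only the finite case needs arithmetic. *)
move=> [a| |] [b| |] [p| |] [q| |]//=; rewrite ?lte_fin => _ _ ab _ q0 p0.
  by move=> [] ?; lra.
Qed.

End iterated_integral.

(* The first integral is a Rintegral, which is 0 unless the integrand is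
   integrable; its positivity therefore includes integrability. *)
Theorem lemma2p8 (R : realType) (n : nat) (s : R) :
  (2 < n)%N -> 0 < s -> s < 1 ->
  let U : 'rV[R]_n -> R := @bubble R n in
  let psi : 'rV[R]_n -> R := @bubble_psi R n in
  let p1 : R := critical_exponent R n in
  [/\ forall x : 'rV[R]_n,
        psi x = (n%:R - 2) / 2 *
                ((1 - enorm x ^+ 2) / (1 + enorm x ^+ 2) `^ (n%:R / 2)),
      0 < \int[lebesgue_rV R n]_x (ln (U x) * U x `^ p1 * psi x),
      gagliardo_exists s U psi
    & (gagliardo s U psi < 0)%E].
Proof.
move=> n2 s0 s1 U psi p1.
have mK := measurable_bubble_kernel s n2.
(* The parts are nonnegative, so Tonelli's theorem identifies their iterated integrals with
   integrals over pairs. *)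
have iterE (f : 'rV[R]_n * 'rV[R]_n -> R) : measurable_fun setT f ->
    (\int[@lebesgue_pair R n]_w (Num.max (f w) 0)%:E =
     \int[lebesgue_rV R n]_x \int[lebesgue_rV R n]_y (Num.max (f (x, y)) 0)%:E)%E.
  move=> mf; apply: integral_lebesgue_pair.
    by apply/measurable_EFinP; apply: measurable_maxr.
  by move=> w; rewrite lee_fin le_max lexx orbT.
have := bubble_kernel_pos_lt_neg n2 s0 s1.
have := bubble_kernel_pos_lty n2 s0 s1.
rewrite (iterE _ mK) (iterE _ (measurable_funN mK)) => pos_oo pos_lt_neg.
split.
- by move=> x; exact: bubble_psiE.
- exact: first_integral_gt0.
- by left.
- exact: (iterated_integral_lt0 mK).
Qed.
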